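(* Let $M,D>0$, let $N\ge 1$ be an integer, and let $W\in\mathcal{W}_\star^{M,D,N}$. Then there exist unique dual optimal multipliers $(\sigma,\lambda,\mu,Z)$ for $W$ (with the convention $\lambda_{i,i}=0$ for all $i$), and they are given by $$\sigma=\frac{M}{2D\sqrt{N+1}},\qquad \lambda_{\star,i}=\frac{1}{N+1},\qquad \mu_i=\frac{D}{2M(N+1)^{3/2}}\quad (i=0,\dots,N),\qquad Z=\sigma ww^\top,$$ where $w=\big[1,-\tfrac{D}{M\sqrt{N+1}},\dots,-\tfrac{D}{M\sqrt{N+1}}\big]^\top\in\mathbb{R}^{N+2}$, together with $\lambda_{i,\star}=0$ for $i=0,\dots,N$, and with the remaining block $(\lambda_{i,j})_{i,j=0,\dots,N}$ equal to the strictly upper triangular array $\lambda(W)$ (that is, $\lambda_{i,j}=0$ for $i\geq j$ and $\lambda_{i,j}=\lambda(W)_{i,j}$ for $i<j$).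
   Context: Matrices. $\mathbb{L}^N$ is the set of real lower triangular $N\times N$ matrices $W$, rows indexed $1,\dots,N$ and columns indexed $0,\dots,N-1$; so the (possibly nonzero) entries are $W_{n,j}$, $0\le j<n\le N$. Empty sums are $0$. Problem class. $\mathtt{P}_{M,D}$ is the set of all pairs $(f,x_0)$, over all dimensions $d$, with $f:\mathbb{R}^d\to\mathbb{R}$ convex and $M$-Lipschitz (Euclidean norm), $x_0\in\mathbb{R}^d$, such that $f$ attains its minimum at some $x_\star$ with $\|x_0-x_\star\|\le D$. Methods. $W\in\mathbb{L}^N$ parameterizes the fixed-step method $x_n=x_0-\sum_{i=0}^{n-1}W_{n,i}g_i$, $n=1,\dots,N$, with arbitrary $g_i\in\partial f(x_i)$. Its worst-case performance is $p_\star(W)=\max\{f(x_N)-f(x_\star)\}$ over all $(f,x_0)\in\mathtt{P}_{M,D}$ and all choices of subgradients. The minimax optimal value is known to be $\frac{MD}{\sqrt{N+1}}$, and $\mathcal{W}_\star^{M,D,N}=\{W\in\mathbb{L}^N: p_\star(W)=\frac{MD}{\sqrt{N+1}}\}$. Dual certificates. Let $\mathcal{I}_N^\star=\{\star,0,1,\dots,N\}$. Let $F=(f_\star,f_0,\dots,f_N)\in\mathbb{R}^{N+2}$ and let $G$ be a symmetric $(N+2)\times(N+2)$ matrix indexed by $\mathcal{I}_N^\star$ (in this order), playing the role of the Gram matrix of $x_0-x_\star,g_0,\dots,g_N$: $G_{\star,\star}=\|x_0-x_\star\|^2$, $G_{\star,i}=\langle x_0-x_\star,g_i\rangle$, $G_{i,j}=\langle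 g_i,g_j\rangle$. The functions $\mathcal{D}=D^2-\|x_0-x_\star\|^2$, $\mathcal{M}_i=M^2-\|g_i\|^2$, $\mathcal{C}_{i,j}=f_i-f_j-\langle g_j,x_i-x_j\rangle$, after substituting $x_n=x_0-\sum_{i<n}W_{n,i}g_i$ and $g_\star=0$, are the following affine functions of $(F,G)$: $\mathcal{D}=D^2-G_{\star,\star}$; $\mathcal{M}_i=M^2-G_{i,i}$ for $0\le i\le N$; $\mathcal{C}_{i,j}=f_i-f_j+\sum_{k=0}^{i-1}W_{i,k}G_{j,k}-\sum_{k=0}^{j-1}W_{j,k}G_{j,k}$ for $0\le i,j\le N$; $\mathcal{C}_{\star,j}=f_\star-f_j+G_{\star,j}-\sum_{k=0}^{j-1}W_{j,k}G_{j,k}$ and $\mathcal{C}_{j,\star}=f_j-f_\star$ for $0\le j\le N$; $\mathcal{C}_{\star,\star}=0$. Dual optimal multipliers for $W$ are nonnegative reals $\sigma$, $\lambda_{i,j}$ ($i,j\in\mathcal{I}_N^\star$), $\mu_i$ ($0\le i\le N$) and a symmetric positive semidefinite $Z\in\mathbb{R}^{(N+2)\times(N+2)}$ such that, identically in $F$ and $G$, $$\sigma\mathcal{D}+\sum_{i,j\in\mathcal{I}_N^\star}\lambda_{i,j}\mathcal{C}_{i,j}+\sum_{i=0}^N\mu_i\mathcal{M}_i+\langle Z,G\rangle=r-(f_N-f_\star)$$ with $r=p_\star(W)$, where $\langle Z,G\rangle=\mathrm{tr}(ZG)$. Since $\mathcal{C}_{i,i}\equiv 0$, the multipliers $\lambda_{i,i}$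 are fixed to be $0$. The map $\lambda(\cdot)$. For $W\in\mathbb{L}^N$ with $W_{n,n-1}>0$ for all $n=1,\dots,N$ (which holds for every $W\in\mathcal{W}_\star^{M,D,N}$), the array $\lambda(W)=(\lambda_{i,n})_{0\le i<n\le N}$ is defined, for each $n=1,\dots,N$, recursively by $$\lambda_{j+1,n}=\frac{1}{W_{j+1,j}}\Big(\frac{D\,W_{n,j}}{M(N+1)^{3/2}W_{n,n-1}}-\frac{D}{M(N+1)^{3/2}}-\sum_{i=j+2}^{n-1}\lambda_{i,n}W_{i,j}\Big),\quad j=n-2,n-3,\dots,0,$$ $$\lambda_{0,n}=\frac{D}{M(N+1)^{3/2}W_{n,n-1}}-\frac{1}{N+1}-\sum_{i=1}^{n-1}\lambda_{i,n}.$$ *)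

(* Defs.v *)
From HB Require Import structures.
From mathcomp Require Import all_boot all_order all_algebra.
From mathcomp Require Import all_classical all_reals all_analysis.

Set Implicit Arguments.
Unset Strict Implicit.
Unset Printing Implicit Defensive.

Import Order.TTheory GRing.Theory Num.Theory.

Local Open Scope classical_set_scope.
Local Open Scope ring_scope.

(* The norm MathComp-Analysis puts on row vectors is the sup norm, so the
   Euclidean structure of R^d is defined here. *)
Definition dot (R : realType) (d : nat) (u v : 'rV[R]_d) : R :=
  \sum_(i < d) u 0 i * v 0 i.

Definition enorm (R : realType) (d : nat) (u : 'rV[R]_d) : R :=
  Num.sqrt (dot u u).

Definition lipschitz_fun (R : realType) (M : R) (d : nat)
    (f : 'rV[R]_d -> R) : Prop :=
  forall x y, `|f x - f y| <= M * enorm (x - y).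

Definition minimizer (R : realType) (d : nat) (f : 'rV[R]_d -> R)
    (xs : 'rV[R]_d) : Prop :=
  forall x, f xs <= f x.

Definition subgradient (R : realType) (d : nat) (f : 'rV[R]_d -> R)
    (x g : 'rV[R]_d) : Prop :=
  forall y, f x + dot g (y - x) <= f y.

(* (f, x0) belongs to P_{M,D}, with witness xs. *)
Definition instance (R : realType) (M D : R) (d : nat) (f : 'rV[R]_d -> R)
    (x0 xs : 'rV[R]_d) : Prop :=
  [/\ @convex_function R 'rV[R]_d setT f, lipschitz_fun M f,
      minimizer f xs & enorm (x0 - xs) <= D].

(* Rows are numbered 1..N and columns 0..N-1: the entry W_{n,j} is stored
   at position (n - 1, j) of the matrix. Indices out of range give 0. *)
Definition entry (R : realType) (N : nat) (W : 'M[R]_N) (n j : nat) : R :=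
  if n is n'.+1 then
    if (insub n' : option 'I_N, insub j : option 'I_N) is (Some a, Some b)
    then W a b else 0
  else 0.

Lemma entryE (R : realType) (N : nat) (W : 'M[R]_N) (a b : 'I_N) :
  entry W a.+1 b = W a b.
Proof. by rewrite /entry !valK. Qed.

(* For n = 0 the sum is empty and the iterate is x0. *)
Definition iterate (R : realType) (N : nat) (W : 'M[R]_N) (d : nat)
    (x0 : 'rV[R]_d) (g : nat -> 'rV[R]_d) (n : nat) : 'rV[R]_d :=
  x0 - \sum_(0 <= i < n) entry W n i *: g i.

Definition gaps (R : realType) (M D : R) (N : nat) (W : 'M[R]_N) : set R :=
  [set v | exists (d : nat) (f : 'rV[R]_d -> R) (x0 xs : 'rV[R]_d)
             (g : nat -> 'rV[R]_d),
     [/\ instance M D f x0 xs,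
         forall i, (i < N)%N -> subgradient f (iterate W x0 g i) (g i)
       & v = f (iterate W x0 g N) - f xs]].

(* The maximum p_star(W), taken as a supremum so that it is always defined. *)
Definition worst_case (R : realType) (M D : R) (N : nat) (W : 'M[R]_N)
    : \bar R :=
  ereal_sup [set v%:E | v in gaps M D W].

(* With the shift of rows, W_{n,j} = 0 for j >= n is the usual lower
   triangularity of the stored matrix. *)
Definition minimax_optimal (R : realType) (M D : R) (N : nat)
    : set 'M[R]_N :=
  [set W | is_trig_mx W /\
           worst_case M D W = (M * D / Num.sqrt N.+1%:R)%:E].

(* The index set {star, 0, ..., N} is 'I_N.+2: star is the first index and
   i in {0, ..., N} is the (i + 1)-st one. *)
Definition star {N : nat} : 'I_N.+2 := ord0.
Definition idx {N : nat} (i : 'I_N.+1) : 'I_N.+2 := lift ord0 i.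

Definition cD (R : realType) (D : R) (N : nat) (G : 'M[R]_N.+2) : R :=
  D ^+ 2 - G star star.

Definition cM (R : realType) (M : R) (N : nat) (G : 'M[R]_N.+2)
    (i : 'I_N.+1) : R :=
  M ^+ 2 - G (idx i) (idx i).

(* unlift ord0 a is None when a = star and Some i when a = idx i. *)
Definition cC (R : realType) (N : nat) (W : 'M[R]_N) (F : 'rV[R]_N.+2)
    (G : 'M[R]_N.+2) (a b : 'I_N.+2) : R :=
  match unlift ord0 a, unlift ord0 b with
  | Some i, Some j =>
      F 0 (idx i) - F 0 (idx j)
      + \sum_(k < N.+1 | (k < i)%N) entry W i k * G (idx j) (idx k)
      - \sum_(k < N.+1 | (k < j)%N) entry W j k * G (idx j) (idx k)
  | None, Some j =>
      F 0 star - F 0 (idx j) + G star (idx j)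
      - \sum_(k < N.+1 | (k < j)%N) entry W j k * G (idx j) (idx k)
  | Some j, None => F 0 (idx j) - F 0 star
  | None, None => 0
  end.

Definition psd (R : realType) (n : nat) (Z : 'M[R]_n) : Prop :=
  Z^T = Z /\ forall v : 'cV[R]_n, 0 <= (v^T *m Z *m v) 0 0.

Record multipliers (R : realType) (N : nat) : Type := Multipliers {
  msigma : R;
  mlambda : 'M[R]_N.+2;
  mmu : 'rV[R]_N.+1;
  mZ : 'M[R]_N.+2
}.

Definition dual_certificate (R : realType) (M D : R) (N : nat) (W : 'M[R]_N)
    (r : R) (q : multipliers R N) : Prop :=
  [/\ [/\ 0 <= msigma q, forall a b, 0 <= mlambda q a b,
          forall i, 0 <= mmu q 0 i & psd (mZ q)],
      forall a, mlambda q a a = 0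
    & forall (F : 'rV[R]_N.+2) (G : 'M[R]_N.+2), G^T = G ->
        msigma q * cD D G
        + \sum_a \sum_b mlambda q a b * cC W F G a b
        + \sum_i mmu q 0 i * cM M G i
        + \tr (mZ q *m G)
        = r - (F 0 (idx ord_max) - F 0 star)].

Definition dual_optimal (R : realType) (M D : R) (N : nat) (W : 'M[R]_N)
    (q : multipliers R N) : Prop :=
  exists2 r : R, worst_case M D W = r%:E & dual_certificate M D W r q.

Definition lam_const (R : realType) (M D : R) (N : nat) : R :=
  D / (M * N.+1%:R `^ (3 / 2)).

(* Column n of lambda(W) after the k entries with row index
   n - 1, ..., n - k have been computed, the other ones being 0. *)
Fixpoint lam_col (R : realType) (M D : R) (N : nat) (W : 'M[R]_N)
    (n k : nat) (m : nat) {struct k} : R :=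
  if k is k'.+1 then
    if m == (n - k)%N then
      if m is j.+1 then
        (entry W j.+1 j)^-1 *
          (lam_const M D N * entry W n j / entry W n n.-1
           - lam_const M D N
           - \sum_(j.+2 <= i < n) lam_col M D W n k' i * entry W i j)
      else
        lam_const M D N / entry W n n.-1 - N.+1%:R^-1
        - \sum_(1 <= i < n) lam_col M D W n k' i
    else lam_col M D W n k' m
  else 0.

(* lambda(W)_{i,n}, for 0 <= i < n <= N. *)
Definition lam (R : realType) (M D : R) (N : nat) (W : 'M[R]_N)
    (i n : nat) : R :=
  lam_col M D W n n i.

Lemma lam_col_stable (R : realType) (M D : R) (N : nat) (W : 'M[R]_N)
    (n k m : nat) : (k <= n)%N -> (n - k <= m)%N ->
  lam_col M D W n k m = lam M D W m n.
Proof.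
move=> kn nkm; rewrite /lam.
suff H p : (k + p <= n)%N -> lam_col M D W n (k + p) m = lam_col M D W n k m.
  by rewrite -{3}(subnKC kn) H // subnKC.
elim: p => [|p IH] h; first by rewrite addn0.
rewrite addnS /= ifF; first by apply: IH; apply: leq_trans h; rewrite addnS.
apply/negbTE/eqP => mE; move: nkm; rewrite mE leqNgt => /negP; apply.
apply: ltn_sub2l; last by rewrite ltnS leq_addr.
by apply: leq_trans h; rewrite addnS ltnS leq_addr.
Qed.

(* The recursion defining lambda(W). *)
Lemma lam_succE (R : realType) (M D : R) (N : nat) (W : 'M[R]_N) (n j : nat) :
  (j.+1 < n)%N ->
  lam M D W j.+1 n = (entry W j.+1 j)^-1 *
    (D * entry W n j / (M * N.+1%:R `^ (3 / 2) * entry W n n.-1)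
     - D / (M * N.+1%:R `^ (3 / 2))
     - \sum_(j.+2 <= i < n) lam M D W i n * entry W i j).
Proof.
move=> jn; rewrite -(@lam_col_stable _ _ _ _ _ _ (n - j.+1)) ?leq_subr //;
  last by rewrite subKn // ltnW.
have -> : (n - j.+1 = (n - j.+2).+1)%N by rewrite -subSn // subSS.
rewrite /= -subSn // subSS subKn ?eqxx; last exact: ltnW.
congr (_ * (_ - _ - _)); first by rewrite /lam_const [in RHS]GRing.invfM mulrA (mulrAC D).
rewrite !big_nat; apply: eq_bigr => i /andP[ji iN].
by rewrite lam_col_stable ?leq_subr // subKn.
Qed.

Lemma lam_zeroE (R : realType) (M D : R) (N : nat) (W : 'M[R]_N) (n : nat) :
  (0 < n)%N ->
  lam M D W 0 n =
    D / (M * N.+1%:R `^ (3 / 2) * entry W n n.-1) - N.+1%:R^-1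
    - \sum_(1 <= i < n) lam M D W i n.
Proof.
case: n => // n _; rewrite {1}/lam /= subnn eqxx.
congr (_ - _ - _); first by rewrite /lam_const [in RHS]GRing.invfM mulrA.
rewrite !big_nat; apply: eq_bigr => i /andP[i1 iN].
by rewrite lam_col_stable // subSn // subnn.
Qed.

(* Main.v *)
(* A certificate is an affine identity in (F, G), so it can be tested on any
   instance. The extremal one has x_0 - x_star = (D / sqrt (N+1)) sum_i e_i,
   g_i = M e_i and all f_i - f_star equal to MD / sqrt (N+1); complementary
   slackness there kills lambda_{i,j} for i > j and lambda_{i,star}, and forces
   Z to be a multiple of w w^T, after which comparing coefficients leaves one
   triangular system per column, whose only solution is lambda(W).

   That lambda(W) is a certificate requires lambda(W) >= 0 and the balance of
   its row and column sums. Both come from perturbing the extremal instance to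
   first order: the gradients of the active constraints are tied by a single
   linear relation, with coefficients sigma, lambda(W), mu, so a violation of
   either condition gives a direction in which all active constraints become
   strict while the gap increases, contradicting p_star(W) = MD / sqrt (N+1).
   The constraints C_{i,j} with j < i are inactive because W_{i,j} > 0:
   otherwise a resisting oracle answers with a repeated subgradient, and N
   orthogonal directions suffice for a gap of at least MD / sqrt N. *)
Require Import Defs.
From HB Require Import structures.
From mathcomp Require Import all_boot all_order all_algebra.
From mathcomp Require Import ring lra.
From mathcomp Require Import all_classical all_reals all_analysis.

Import Order.TTheory GRing.Theory Num.Theory.

Local Open Scope classical_set_scope.
Local Open Scope ring_scope.

(** * Convex interpolation *)

Section EuclideanDot.
Variables (R : realType) (d : nat).
Implicit Types (u v w : 'rV[R]_d) (a M : R).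

Lemma dotC u v : dot u v = dot v u.
Proof. by apply: eq_bigr => i _; rewrite mulrC. Qed.

Lemma dotDr u v w : dot u (v + w) = dot u v + dot u w.
Proof. by rewrite -big_split; apply: eq_bigr => i _; rewrite mxE mulrDr. Qed.

Lemma dotZr a u v : dot u (a *: v) = a * dot u v.
Proof. by rewrite /dot mulr_sumr; apply: eq_bigr => i _;
  rewrite mxE mulrCA. Qed.

Lemma dotNr u v : dot u (- v) = - dot u v.
Proof. by rewrite -scaleN1r dotZr mulN1r. Qed.

Lemma dotBr u v w : dot u (v - w) = dot u v - dot u w.
Proof. by rewrite dotDr dotNr. Qed.

Lemma dot0r u : dot u 0 = 0.
Proof. by rewrite -(scale0r 0) dotZr mul0r. Qed.

Lemma dot_sumr (I : Type) (r : seq I) (P : pred I) u (F : I -> 'rV[R]_d) :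
  dot u (\sum_(i <- r | P i) F i) = \sum_(i <- r | P i) dot u (F i).
Proof. exact: (big_morph _ (dotDr u) (dot0r u)). Qed.

Lemma dotDl u v w : dot (u + v) w = dot u w + dot v w.
Proof. by rewrite dotC dotDr !(dotC w). Qed.

Lemma dotZl a u v : dot (a *: u) v = a * dot u v.
Proof. by rewrite dotC dotZr dotC. Qed.

Lemma dot_ge0 u : 0 <= dot u u.
Proof. by apply: sumr_ge0 => i _; rewrite -expr2 sqr_ge0. Qed.

Lemma dot_eq0 u : dot u u = 0 -> u = 0.
Proof.
move=> /eqP; rewrite psumr_eq0 => [/allP h|i _]; last by rewrite -expr2 sqr_ge0.
apply/rowP => i; rewrite mxE; apply/eqP.
by have := h i (mem_index_enum _); rewrite mulf_eq0 orbb.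
Qed.

Lemma dot_CauchySchwarz u v : dot u v ^+ 2 <= dot u u * dot v v.
Proof.
(* This square equals [dot v v] times the difference of the two sides, so no division occurs until
   [v] is known to be nonzero. *)
have := dot_ge0 (dot v v *: u - dot u v *: v).
rewrite dotBr (dotC _ (_ *: u)) (dotC _ (_ *: v)) !dotBr !dotZr !dotZl.
rewrite (dotC v u) => h.
have [v0|v0] := eqVneq (dot v v) 0.
  by rewrite (dot_eq0 _ v0) !dot0r expr0n mulr0.
have vp : 0 < dot v v by rewrite lt_def v0 dot_ge0.
by rewrite -(ler_pM2l vp); lra.
Qed.

Lemma dot_le_enorm M u v : 0 <= M -> dot u u <= M ^+ 2 ->
  dot u v <= M * enorm v.
Proof.
move=> M0 hu; apply: le_trans (ler_norm _) _.
rewrite -(ler_pXn2r (n := 2)) // ?nnegrE ?mulr_ge0 ?sqrtr_ge0 //.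
rewrite real_normK ?num_real // exprMn sqr_sqrtr ?dot_ge0 //.
by apply: le_trans (dot_CauchySchwarz _ _) _; rewrite ler_wpM2r ?dot_ge0.
Qed.

Lemma enormN u : enorm (- u) = enorm u.
Proof. by rewrite /enorm -scaleN1r dotZl dotZr !mulN1r opprK. Qed.

Lemma enorm_le a u : 0 <= a -> dot u u <= a ^+ 2 -> enorm u <= a.
Proof. by move=> a0 h;
  rewrite /enorm -(ger0_norm a0) -sqrtr_sqr ler_wsqrtr. Qed.

End EuclideanDot.

Lemma iterateE (R : realType) (N d : nat) (W : 'M[R]_N) (x0 : 'rV[R]_d)
    (g : 'I_N.+1 -> 'rV[R]_d) (i : nat) : (i <= N)%N ->
  iterate W x0 (fun m => g (inord m)) i
  = x0 - \sum_(k < N.+1 | (k < i)%N) entry W i k *: g k.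
Proof.
move=> iN; congr (_ - _);
  rewrite big_mkord (big_ord_widen N.+1 (fun k => entry W i k *: g (inord k)))
    ?leqW //.
by apply: eq_bigr => k _; rewrite inord_val.
Qed.

(* The function realizing the data is the maximum of the affine minorants
   given by the data and of the constant minorant at the minimizer 0. *)
Lemma interpolation_gaps (R : realType) (M D : R) (N d : nat) (W : 'M[R]_N)
    (p : 'rV[R]_d) (g : 'I_N.+1 -> 'rV[R]_d) (fv : 'I_N.+1 -> R) (fs : R)
    (x := fun i : 'I_N.+1 =>
            p - \sum_(k < N.+1 | (k < i)%N) entry W i k *: g k) :
  0 <= M -> 0 <= D -> dot p p <= D ^+ 2 ->
  (forall i, dot (g i) (g i) <= M ^+ 2) ->
  (forall i, fs <= fv i) ->
  (forall j, fv j - dot (g j) (x j) <= fs) ->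
  (forall i j, fv j + dot (g j) (x i - x j) <= fv i) ->
  gaps M D W (fv ord_max - fs).
Proof.
move=> M0 D0 hp hg hfs hs hc.
pose f (y : 'rV[R]_d) :=
  \big[Num.max/fs]_(j < N.+1) (fv j + dot (g j) (y - x j)).
have f_ge j y : fv j + dot (g j) (y - x j) <= f y by exact: le_bigmax.
have f_lb y : fs <= f y by exact: bigmax_ge_id.
have fx i : f (x i) = fv i.
  apply: le_anti; apply/andP; split; first exact: bigmax_le.
  by apply: le_trans (f_ge i (x i)); rewrite subrr dot0r addr0.
have f0 : f 0 = fs.
  apply: le_anti; rewrite f_lb andbT; apply: bigmax_le => // j _.
  by rewrite sub0r dotNr hs.
have f_lip y z : f y <= f z + M * enorm (y - z).
  apply: bigmax_le => [|j _].
    by apply: ler_wpDr; rewrite ?mulr_ge0 ?sqrtr_ge0 ?f_lb.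
  have -> : y - x j = (z - x j) + (y - z) by rewrite [RHS]addrC addrA subrK.
  by rewrite dotDr addrA lerD // dot_le_enorm.
exists d, f, p, 0, (fun m => g (inord m)); split.
- split.
  + move=> t y z _ _; rewrite convRE.
    have t1 : t%:num + (1 - t%:num) = 1 :> R by rewrite addrC subrK.
    have t0 : 0 <= t%:num :> R by [].
    have t2 : 0 <= 1 - t%:num :> R by rewrite subr_ge0.
    apply: bigmax_le => [|j _].
      rewrite -[leLHS]mul1r -{1}t1 mulrDl.
      by apply: lerD; apply: ler_wpM2l.
    have -> : (fv j + dot (g j) (conv t y z - x j)) =
        t%:num * (fv j + dot (g j) (y - x j))
        + (1 - t%:num) * (fv j + dot (g j) (z - x j)).
      have -> : conv t y z = t%:num *: (y : 'rV[R]_d) + (1 - t%:num) *: (z :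
        'rV[R]_d) by [].
      rewrite !dotBr dotDr !dotZr; ring.
    by apply: lerD; apply: ler_wpM2l.
  + move=> y z; rewrite ler_norml; apply/andP; split.
      by rewrite lerNl opprB lerBlDl -enormN opprB f_lip.
    by rewrite lerBlDl f_lip.
  + by move=> y; rewrite f0.
  + by rewrite subr0 enorm_le.
- move=> i iN y; rewrite iterateE 1?ltnW //.
  have := fx (inord i); rewrite /x /= inordK ?ltnS 1?ltnW // => ->.
  by apply: le_trans (f_ge (inord i) y); rewrite /x /= inordK ?ltnS 1?ltnW.
- by rewrite f0 iterateE // -(fx ord_max).
Qed.

Lemma dot_iterateB (R : realType) (N d : nat) (W : 'M[R]_N) (p : 'rV[R]_d) (g :
  'I_N.+1 -> 'rV[R]_d)
   (v : 'rV[R]_d) (i : nat) :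
  dot v (p - \sum_(k < N.+1 | (k < i)%N) entry W i k *: g k)
  = dot v p - \sum_(k < N.+1 | (k < i)%N) entry W i k * dot v (g k).
Proof. by rewrite dotBr dot_sumr; under eq_bigr do rewrite dotZr. Qed.

(** * Positivity of the step sizes *)

Section ResistingOracle.
Variables (R : realType) (N : nat) (W : 'M[R]_N.+1).
Implicit Types (k : nat -> 'I_N.+1) (l : 'I_N.+1).

(* Coordinate l of x_i - x_0 when the m-th subgradient is the basis vector
   with index k m. *)
Definition drift k (i : nat) l : R :=
  - \sum_(m < i) entry W i m * (k m == l)%:R.

(** The condition that, from a starting point with equal coordinates, answer [k i] be a largest
    coordinate of the iterate, so that its basis vector is a subgradient of the maximum of the
    coordinates. *)
Definition greedy k (i : nat) : Prop := forall l, drift k i l <= drift k i (k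
  i).

Lemma eq_drift k k' i l : (forall m, (m < i)%N -> k m = k' m) ->
  drift k i l = drift k' i l.
Proof. by move=> h; congr (- _); apply: eq_bigr => m _; rewrite h. Qed.

Lemma drift_unused k i l : (forall m, (m < i)%N -> k m != l) ->
  drift k i l = 0.
Proof.
by move=> h; rewrite /drift big1 ?oppr0 // => m _;
  rewrite (negbTE (h m _)) ?mulr0.
Qed.

Lemma drift_inord i l : (i <= N.+1)%N ->
  drift (fun m => inord m) i l = if (l < i)%N then - entry W i l else 0.
Proof.
move=> iN; case: ltnP => li; last first.
  apply: drift_unused => m mi; apply/eqP => ml; move: li; rewrite -ml inordK //.
    by rewrite leqNgt mi.
  exact: leq_trans iN.
rewrite /drift (bigD1 (Ordinal li)) //= inord_val eqxx mulr1 big1 ?addr0 // =>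
  m ml.
case: eqP => [e|]; last by rewrite mulr0.
case/eqP: ml; apply: val_inj => /=; rewrite -e inordK //.
exact: leq_trans (ltn_ord m) iN.
Qed.

(** The drift at step i depends only on answers before i, so each new answer can be an argmax of the
    current drift without spoiling the earlier ones. *)
Lemma greedy_extension k0 s : (forall i, (i < s)%N -> greedy k0 i) ->
  exists k, (forall m, (m < s)%N -> k m = k0 m) /\
    (forall i, (i <= N.+1)%N -> greedy k i).
Proof.
move=> h0.
suff [k [kk0 hk]] : exists k, (forall m, (m < s)%N -> k m = k0 m) /\
    (forall i, (i < s + N.+2)%N -> greedy k i).
  by exists k; split => // i iN; apply: hk;
    rewrite (leq_trans _ (leq_addl _ _)).
elim: N.+2 => [|t [k [kk0 hk]]]; first by exists k0; split => // i;
  rewrite addn0; exact: h0.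
pose l0 := [arg max_(l > ord0) drift k (s + t) l]%O.
pose k' m := if m == (s + t)%N then l0 else k m.
have k'E i l : (i <= s + t)%N -> drift k' i l = drift k i l.
  by move=> ist; apply: eq_drift => m mi; rewrite /k' ltn_eqF // (leq_trans mi).
exists k'; split => [m ms|i].
  by rewrite /k' ltn_eqF ?kk0 // (leq_trans ms) ?leq_addr.
rewrite addnS ltnS leq_eqVlt => /orP[/eqP -> l|ist l].
  rewrite !k'E // /k' eqxx /l0; case: Order.TotalTheory.arg_maxP => // l1 _;
    exact.
by rewrite !k'E ?(ltnW ist) // /k' ltn_eqF //; apply: hk.
Qed.

Lemma unused_index k i : (i < N.+1)%N ->
  exists l, forall m, (m < i)%N -> k m != l.
Proof.
move=> iN; apply: contrapT => h.
have: (#|[set: 'I_N.+1]%SET| <= #|[set k m | m : 'I_i]%SET|)%N.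
  apply: subset_leq_card; apply/fintype.subsetP => l _; apply/imsetP.
  apply: contrapT => hl; apply: h; exists l => m mi; apply/eqP => kml.
  by apply: hl; exists (Ordinal mi).
rewrite cardsT card_ord leqNgt => /negP; apply.
by apply: leq_ltn_trans (leq_imset_card _ _) _; rewrite card_ord.
Qed.

(** Pigeonhole after deleting the repeated answer b: the remaining N answers cannot exhaust N+1
    indices. *)
Lemma unused_index_repeated k a b : (a < b)%N -> (b <= N)%N -> k a = k b ->
  exists l, forall m, (m < N.+1)%N -> k m != l.
Proof.
move=> ab bN kab.
have [l hl] := unused_index (fun m => k (if (m < b)%N then m else m.+1)) N
  (ltnSn N).
exists l => m mN; have [mb|bm|mb] := ltngtP m b.
- by have := hl m (leq_trans mb bN); rewrite mb.
- case: m mN bm => // m mN bm; have := hl m mN.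
  by rewrite ltnNge -ltnS bm.
- by have := hl a (leq_trans ab bN); rewrite ab kab mb.
Qed.

Lemma resisting_indices n j : (j < n)%N -> (n <= N.+1)%N ->
  (forall i m, (m < i)%N -> (i < n)%N -> 0 < entry W i m) ->
  entry W n j <= 0 ->
  exists k, (forall i, (i <= N.+1)%N -> greedy k i) /\
    (forall i, (i <= N.+1)%N -> exists l, 0 <= drift k i l).
Proof.
move=> jn nN Wpos Wnj.
pose k0 : nat -> 'I_N.+1 := fun m => inord m.
have k0_greedy i : (i < n)%N -> greedy k0 i.
  move=> ilt l; rewrite /k0 !drift_inord ?(leq_trans (ltnW ilt)) //.
  rewrite inordK ?ltnn; last exact: leq_trans nN.
  by case: ifP => // li; rewrite oppr_le0 ltW ?Wpos.
have jN : (j < N.+1)%N by exact: leq_trans nN.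
have k0_drift : 0 <= drift k0 n (Ordinal jN).
  by rewrite drift_inord //= jn oppr_ge0.
suff [k [kg [l hl]]] : exists k, (forall i, (i <= N.+1)%N -> greedy k i) /\
    exists l, 0 <= drift k N.+1 l.
  exists k; split => // i; rewrite leq_eqVlt => /orP[/eqP ->|iN];
    first by exists l.
  by have [l' hl'] := unused_index k i iN; exists l'; rewrite drift_unused.
move: nN; rewrite leq_eqVlt => /orP[/eqP nE|nN].
  have [k [kk0 kg]] := greedy_extension _ _ k0_greedy.
  exists k; split => //; exists (Ordinal jN).
  by rewrite -[X in drift _ X _]nE (eq_drift _ _ _ _ kk0).
pose l0 := [arg max_(l > Ordinal jN) drift k0 n l]%O.
have l0max l : drift k0 n l <= drift k0 n l0.
  by rewrite /l0; case: Order.TotalTheory.arg_maxP => // l1 _; exact.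
(* When no index below n maximizes, the maximum is 0, attained also by j. *)
pose l1 := if (l0 < n)%N then l0 else Ordinal jN.
have l1n : (l1 < n)%N by rewrite /l1; case: ifP.
have l1max l : drift k0 n l <= drift k0 n l1.
  rewrite /l1; case: ifP => // l0n; apply: le_trans (l0max l) _.
  by apply: le_trans k0_drift; rewrite drift_inord ?l0n // ltnW.
pose k1 m := if m == n then l1 else k0 m.
have k1E i l : (i <= n)%N -> drift k1 i l = drift k0 i l.
  by move=> ist; apply: eq_drift => m mi; rewrite /k1 ltn_eqF // (leq_trans mi).
have k1_greedy i : (i < n.+1)%N -> greedy k1 i.
  rewrite ltnS leq_eqVlt => /orP[/eqP -> l|ilt l].
    by rewrite !k1E // /k1 eqxx.
  by rewrite !k1E ?(ltnW ilt) // /k1 ltn_eqF //; apply: k0_greedy.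
have [k [kk1 kg]] := greedy_extension _ _ k1_greedy.
exists k; split => //.
have kl1 : k l1 = k n.
  rewrite !kk1 ?(ltn_trans l1n) // /k1 eqxx ltn_eqF // /k0.
  exact: inord_val.
have [l hl] := unused_index_repeated _ _ _ l1n nN kl1.
by exists l; rewrite drift_unused.
Qed.

End ResistingOracle.

Arguments drift {R N} W k i l.
Arguments greedy {R N} W k i.

(** The data are those of M times the maximum of the coordinates, started from the vector with all
    coordinates D / sqrt(N+1). The minimal value is taken to be 0, and the largest coordinate never
    falls below its initial value. *)
Lemma resisting_gap (R : realType) (M D : R) (N : nat) (W : 'M[R]_N.+1) k :
  0 < M -> 0 < D ->
  (forall i, (i <= N.+1)%N -> greedy W k i) ->
  (forall i, (i <= N.+1)%N -> exists l, 0 <= drift W k i l) ->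
  exists2 v, gaps M D W v & M * D / Num.sqrt N.+1%:R <= v.
Proof.
move=> M0 D0 kg kd.
have kk_ge0 i : (i <= N.+1)%N -> 0 <= drift W k i (k i).
  by move=> iN; have [l hl] := kd i iN; apply: le_trans hl (kg i iN l).
set s := Num.sqrt N.+1%:R.
have s0 : 0 < s by rewrite sqrtr_gt0 ltr0n.
pose p : 'rV[R]_N.+1 := const_mx (D / s).
pose g (i : 'I_N.+2) : 'rV[R]_N.+1 := M *: delta_mx 0 (k i).
pose x := fun i : 'I_N.+2 =>
            p - \sum_(m < N.+2 | (m < i)%N) entry W i m *: g m.
have dotg i (v : 'rV[R]_N.+1) : dot (g i) v = M * v 0 (k i).
  rewrite dotZl /dot (bigD1 (k i)) //= big1 ?addr0 ?mxE ?eqxx ?mul1r //.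
  by move=> l lk; rewrite mxE eqxx (negbTE lk) mul0r.
have xE i l : x i 0 l = D / s + M * drift W k i l.
  rewrite /x !mxE summxE /drift mulrN mulr_sumr; congr (_ - _).
  rewrite (big_ord_widen N.+2 (fun m => M * (entry W i m * (k m == l)%:R)))
    1?ltnW //.
  apply: eq_bigr => m _; rewrite !mxE eqxx /= eq_sym; ring.
have xle i j : dot (g j) (x i) <= dot (g i) (x i).
  by rewrite !dotg !xE !(ler_pM2l M0, lerD2l); apply: kg; rewrite -ltnS.
exists (dot (g ord_max) (x ord_max) - 0).
  apply: (interpolation_gaps _ M D _ _ W p g (fun i => dot (g i) (x i)));
    rewrite ?(ltW M0) ?(ltW D0) //.
  - rewrite /dot; under eq_bigr do rewrite !mxE.
    rewrite sumr_const card_ord -mulr_natl -{1}(sqr_sqrtr (ler0n _ _)) -/s.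
    by rewrite le_eqVlt; apply/orP; left; apply/eqP; field; rewrite gt_eqF.
  - by move=> i; rewrite dotg !mxE !eqxx mulr1 expr2.
  - move=> i; rewrite dotg xE.
    apply: mulr_ge0 (ltW M0) _; apply: addr_ge0;
      first exact: divr_ge0 (ltW D0) (ltW s0).
    by apply: mulr_ge0 (ltW M0) _; apply: kk_ge0; rewrite -ltnS.
  - by move=> j; rewrite subrr.
  - by move=> i j; rewrite dotBr addrC subrK xle.
rewrite subr0 dotg xE mulrDr mulrA lerDl.
by rewrite !mulr_ge0 ?(ltW M0) ?kk_ge0.
Qed.

Lemma gaps_le_worst_case (R : realType) (M D r v : R) (N : nat) (W : 'M[R]_N) :
  worst_case M D W = r%:E -> gaps M D W v -> v <= r.
Proof. by move=> Wr gv; rewrite -lee_fin -Wr; apply: ereal_sup_ubound;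
  exists v. Qed.

(** Strong induction on the row: in the first row with a nonpositive entry the resisting oracle
    yields a gap of at least MD / sqrt(N), which exceeds the optimal value. *)
Lemma minimax_optimal_entry_gt0 (R : realType) (M D : R) (N : nat)
    (W : 'M[R]_N) : 0 < M -> 0 < D -> minimax_optimal M D W ->
  forall n j, (j < n)%N -> (n <= N)%N -> 0 < entry W n j.
Proof.
move=> M0 D0; case: N W => [|N] W [_ Wr] n; first by case: n => // n j _.
elim/ltn_ind: n => n IH j jn nN; rewrite ltNge; apply/negP => Wnj.
have [i m mi ilt|k [kg kd]] := resisting_indices R N W n j jn nN _ Wnj.
  by apply: IH => //; apply: leq_trans (ltnW ilt) nN.
have [v /(gaps_le_worst_case _ _ _ _ _ _ _ Wr) vr] := resisting_gap _ _ _ _ _ _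
  M0 D0 kg kd.
move=> /le_trans /(_ vr); apply/negP; rewrite -ltNge.
rewrite ltr_pM2l ?mulr_gt0 // ltf_pV2 ?posrE ?sqrtr_gt0 ?ltr0n //.
by rewrite ltr_sqrt ?ltr0n // ltr_nat.
Qed.

(** * The triangular systems defining lambda(W) *)

Section ColumnPairing.
Variables (R : fieldType) (n : nat) (w : nat -> nat -> R).
Implicit Types X a : 'I_n -> R.

(* The part of C_{i,j} that is linear in the column X_k = <g_j, g_k>, k < j,
   of the Gram matrix (for i < j). *)
Definition colform X (i j : nat) : R :=
  \sum_(k < n | (k < i)%N) w i k * X k - \sum_(k < n | (k < j)%N) w j k * X k.

(* The coefficient of <g_j, g_k>, k < j, in the weighted sum of the C_{i,j}
   over i < j and of C_{star,j}, with respective weights a i and l. *)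
Definition colcoef (l : R) a (j k : nat) : R :=
  \sum_(i < n | (k < i < j)%N) a i * w i k
  - (l + \sum_(i < n | (i < j)%N) a i) * w j k.

(** Exchanging the sums exhibits [colcoef] and [colform] as transposed operators. Solvability of the
    system in X thus gives injectivity in the weights. *)
Lemma colform_pairing l a X (j : 'I_n) :
  \sum_(i < n | (i < j)%N) a i * colform X i j
    - l * \sum_(k < n | (k < j)%N) w j k * X k
  = \sum_(k < n | (k < j)%N) colcoef l a j k * X k.
Proof.
under eq_bigr do rewrite mulrBr mulr_sumr.
rewrite sumrB (exchange_big_dep (fun k : 'I_n => (k < j)%N)) /=; last first.
  by move=> i k ij ki; exact: ltn_trans ij.
under [RHS]eq_bigr do rewrite mulrBl mulr_suml -mulrA.
rewrite sumrB -!mulr_sumr -mulr_suml -addrA -opprD -mulrDl (addrC l).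
congr (_ - _); apply: eq_bigr => k kj.
apply: eq_big => [i|i _]; first by rewrite andbC.
by rewrite mulrA.
Qed.

Lemma triangular_solve m (y : nat -> R) :
  (forall i, (i < m)%N -> w i.+1 i != 0) ->
  exists X : nat -> R, forall i, (0 < i <= m)%N ->
    \sum_(k < i) w i k * X k = y i.
Proof.
elim: m => [|m IH] w0.
  by exists (fun=> 0); case.
have [i im|X hX] := IH; first exact: w0 (ltnW im).
pose X' k := if k == m then (y m.+1 - \sum_(k < m) w m.+1 k * X k) / w m.+1 m
             else X k.
have X'E i : (i <= m)%N ->
    forall p, \sum_(k < i) w p k * X' k = \sum_(k < i) w p k * X k.
  by move=> im p; apply: eq_bigr => k _;
    rewrite /X' ltn_eqF // (leq_trans (ltn_ord k)).
exists X' => i /andP[i0]; rewrite leq_eqVlt => /orP[/eqP ->|im].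
  rewrite big_ord_recr /= X'E // /X' eqxx mulrC divfK ?w0 //.
  by rewrite addrC subrK.
by rewrite X'E // hX // i0.
Qed.

End ColumnPairing.

Arguments colform {R n} w X i j.
Arguments colcoef {R n} w l a j k.

Lemma colform_solve (R : fieldType) (n : nat) (w : nat -> nat -> R) (j : 'I_n)
    (y : 'I_n -> R) :
  (forall i, (i.+1 < n)%N -> w i.+1 i != 0) ->
  exists X : 'I_n -> R,
    forall i : 'I_n, (i < j)%N -> colform w X i j = y i.
Proof.
case: n j y => [[]//|m] j y w0.
(* Row 0 is an empty sum, so the equation for i = 0 forces row j to sum to - y 0; the rows in
   between must then sum to y i - y 0. *)
pose b (i : nat) := (if (i < j)%N then y (inord i) else 0) - y ord0.
have [i im|X hX] := triangular_solve R w m b.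
  exact: w0.
have sumX (i : nat) : (i <= m)%N -> \sum_(k < m.+1 | (k < i)%N) w i k * X k
     = \sum_(k < i) w i k * X k.
  by move=> im; rewrite (big_ord_widen m.+1 (fun k => w i k * X k)) // leqW.
have jm : (j <= m)%N by rewrite -ltnS.
exists (fun k => X k) => i ij; have im : (i <= m)%N by rewrite -ltnS.
rewrite /colform !sumX //.
rewrite (hX j) ?(leq_trans _ ij) // /b ltnn.
have [i0|i0] := posnP i.
  by rewrite i0 big_ord0 !sub0r opprK; congr y; apply: val_inj.
rewrite hX ?i0 // /b ij inord_val.
by rewrite sub0r opprK subrK.
Qed.

(** * The recursion for lambda(W) as a triangular linear system *)

Lemma powR_three_halves (R : realType) (x : R) : 0 < x ->
  x `^ (3 / 2) = x * Num.sqrt x.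
Proof.
move=> x0; have -> : 3 / 2 = 1 + 2^-1 :> R by field.
by rewrite powRD ?gt_eqF ?implybT // powRr1 ?ltW // powR12_sqrt ?ltW.
Qed.

Lemma lam_constE (R : realType) (M D : R) (N : nat) :
  lam_const M D N = D / (M * Num.sqrt N.+1%:R) / N.+1%:R.
Proof.
rewrite /lam_const powR_three_halves ?ltr0n // (mulrC N.+1%:R) mulrA.
by rewrite [in LHS]invfM mulrA.
Qed.

(** The formula for row 0 fixes the column sum, which is the equation for k = j - 1; each other step
    of the recursion is the equation for one k < j - 1, solved for row k + 1. *)
Lemma lam_colcoef (R : realType) (M D : R) (N : nat) (W : 'M[R]_N)
    (j k : 'I_N.+1) :
  (forall i, (i < N)%N -> entry W i.+1 i != 0) -> (k < j)%N ->
  colcoef (entry W) N.+1%:R^-1 (fun i : 'I_N.+1 => lam M D W i j) j k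
  = - lam_const M D N.
Proof.
move=> W0 kj; have j0 : (0 < j)%N by exact: leq_trans kj.
have sumE (F : nat -> R) (m : nat) :
    \sum_(i < N.+1 | (m <= i < j)%N) F i = \sum_(m <= i < j) F i.
  rewrite big_geq_mkord (big_ord_widen_cond N.+1 (fun i => (m <= i)%N) F)
    1?ltnW //.
have Wj : entry W j j.-1 != 0.
  by rewrite -{1}(prednK j0) W0 // prednK // -ltnS.
rewrite /colcoef (sumE (fun i => lam M D W i j * entry W i k) k.+1).
rewrite (sumE (fun i => lam M D W i j) 0%N) (big_ltn j0) lam_zeroE // subrK.
rewrite (addrC N.+1%:R^-1) subrK invfM mulrA -/(lam_const M D N).
have [jk|kj1] := leqP j k.+1.
  have -> : j = k.+1 :> nat by apply/eqP; rewrite eqn_leq jk.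
  by rewrite big_geq // sub0r mulfVK ?W0 // (leq_trans kj) // -ltnS.
have Wk : entry W k.+1 k != 0 by rewrite W0 // -ltnS (leq_trans kj1) // ltnW.
rewrite big_ltn // lam_succE // (mulrAC (entry W k.+1 k)^-1) mulVf // mul1r
  subrK.
rewrite [X in D * _ * X]invfM /lam_const.
ring.
Qed.

(** * Perturbation of the extremal instance *)

(** First-order feasibility test: a constraint that is slack at t = 0, or active with positive
    derivative, survives small t > 0 whatever its second-order term. *)
Lemma quadratic_near_ge0 (R : realType) (a b c : R) :
  0 < a \/ a = 0 /\ 0 < b ->
  \forall t \near 0^'+, 0 <= a + t * b + t ^+ 2 * c.
Proof.
case=> [a0|[-> b0]].
- have s0 : 0 < `|b| + `|c| + 1 by rewrite ltr_wpDl // addr_ge0.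
  near=> t.
  have t0 : 0 < t by near: t; exact: nbhs_right_gt.
  have t1 : t < 1 by near: t; exact: nbhs_right_lt.
  have : t < a / (`|b| + `|c| + 1).
    by near: t; apply: nbhs_right_lt; rewrite divr_gt0.
  rewrite ltr_pdivlMr // => ta.
  have hb : t * - `|b| <= t * b by rewrite ler_wpM2l ?(ltW t0) // lerNl -normrN
    ler_norm.
  have hc : t ^+ 2 * - `|c| <= t ^+ 2 * c.
    by rewrite ler_wpM2l ?sqr_ge0 // lerNl -normrN ler_norm.
  have hcc : t ^+ 2 * `|c| <= t * `|c|.
    by rewrite ler_wpM2r // expr2 ler_piMr ?ltW.
  lra.
- have s0 : 0 < `|c| + 1 by rewrite ltr_wpDl.
  near=> t.
  have t0 : 0 < t by near: t; exact: nbhs_right_gt.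
  have : t < b / (`|c| + 1).
    by near: t; apply: nbhs_right_lt; rewrite divr_gt0.
  rewrite ltr_pdivlMr // => tb.
  have -> : 0 + t * b + t ^+ 2 * c = t * (b + t * c) by ring.
  apply: mulr_ge0; first exact: ltW.
  have hc : t * - `|c| <= t * c by rewrite ler_wpM2l ?(ltW t0) // lerNl -normrN
    ler_norm.
  lra.
Unshelve. all: by end_near. Qed.

Section ColformLinear.
Variables (R : fieldType) (n : nat) (w : nat -> nat -> R).

Lemma colform_quadratic (G G0 G1 G2 : 'I_n -> R) (t : R) (i j : nat) :
  (forall k, G k = G0 k + t * G1 k + t ^+ 2 * G2 k) ->
  colform w G i j
  = colform w G0 i j + t * colform w G1 i j + t ^+ 2 * colform w G2 i j.
Proof.
move=> GE; have sumE (p m : nat) : \sum_(k < n | (k < m)%N) w p k * G k =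
   \sum_(k < n | (k < m)%N) w p k * G0 k
   + t * (\sum_(k < n | (k < m)%N) w p k * G1 k)
   + t ^+ 2 * \sum_(k < n | (k < m)%N) w p k * G2 k.
  by rewrite !mulr_sumr -!big_split; apply: eq_bigr => k _ /=; rewrite GE; ring.
by rewrite /colform !sumE; ring.
Qed.

Lemma eq_colform (G H : 'I_n -> R) (i j : nat) : (i <= j)%N ->
  (forall k : 'I_n, (k < j)%N -> G k = H k) ->
  colform w G i j = colform w H i j.
Proof.
move=> ij GH; rewrite /colform; congr (_ - _); apply: eq_bigr => k ki.
  by rewrite GH // (leq_trans ki).
by rewrite GH.
Qed.

(** Describes the extremal instance, whose gradients are orthogonal: C_{i,j} is active for i <= j
    and has slack a W_{i,j} for j < i. *)
Lemma colform_diag (G : 'I_n -> R) (a : R) (i j : 'I_n) :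
  (forall k, G k = a *+ (j == k)) ->
  colform w G i j = (a * w i j) *+ (j < i)%N.
Proof.
move=> GE; have sumE (p m : nat) :
    \sum_(k < n | (k < m)%N) w p k * G k = (a * w p j) *+ (j < m)%N.
  case: ltnP => jm.
    rewrite (bigD1 j) //= GE eqxx mulr1n big1 ?addr0 1?mulrC // => k /andP[_
      kj].
    by rewrite GE eq_sym (negbTE kj) mulr0n mulr0.
  rewrite big1 // => k km; rewrite GE; case: eqP => [jk|];
    last by rewrite mulr0.
  by move: km; rewrite -jk ltnNge jm.
by rewrite /colform !sumE ltnn subr0.
Qed.
End ColformLinear.

(* The coefficient of f_n in the sum of the lambda_{i,j} C_{i,j}, where
   lambda_{star,j} = 1 / (N + 1). *)
Definition imbalance {R : realType} (M D : R) {N : nat} (W : 'M[R]_N)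
    (n : 'I_N.+1) : R :=
  \sum_(j < N.+1 | (n < j)%N) lam M D W n j
  - \sum_(i < N.+1 | (i < n)%N) lam M D W i n - N.+1%:R^-1.

Lemma imbalance_pairing (R : realType) (M D : R) (N : nat) (W : 'M[R]_N)
    (f : 'I_N.+1 -> R) :
  \sum_n imbalance M D W n * f n =
  \sum_(j < N.+1) \sum_(i < N.+1 | (i < j)%N) lam M D W i j * (f i - f j)
  - N.+1%:R^-1 * \sum_n f n.
Proof.
under eq_bigr do rewrite /imbalance !mulrBl !mulr_suml.
rewrite !sumrB -mulr_sumr; congr (_ - _).
rewrite (exchange_big_dep predT) //= -sumrB; apply: eq_bigr => j _.
by rewrite -sumrB; apply: eq_bigr => i _; rewrite mulrBr.
Qed.

Section Perturbation.
Variables (R : realType) (M D : R) (N : nat) (W : 'M[R]_N).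
Variables (a : 'I_N.+1 -> 'I_N.+1 -> R) (df : 'I_N.+1 -> R).
Hypotheses (M0 : 0 < M) (D0 : 0 < D).
Hypothesis W0 : forall n j, (j < n)%N -> (n <= N)%N -> 0 < entry W n j.
Let c := D / (M * Num.sqrt N.+1%:R).
Let l : R := N.+1%:R.
Let lambda (i j : nat) := lam M D W i j.

(** Pairing the prescribed rates with lambda(W) makes every coefficient of X equal to - c / l. This
    gives the plain sum of X, up to the row-j term, without solving for X. *)
Lemma perturbation_column (X : 'I_N.+1 -> R) (j : 'I_N.+1) :
  (forall i : 'I_N.+1, (i < j)%N -> colform (entry W) X i j = a i j - (df i -
    df j)) ->
  c * \sum_(k < N.+1 | (k < j)%N) X k =
    \sum_(k < N.+1 | (k < j)%N) entry W j k * X k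
    - l * \sum_(i < N.+1 | (i < j)%N) lambda i j * (a i j - (df i - df j)).
Proof.
move=> hX; have l0 : l != 0 by rewrite pnatr_eq0.
have := colform_pairing R N.+1 (entry W) l^-1 (fun i => lambda i j) X j.
under eq_bigr => i ij do rewrite hX //.
under [RHS]eq_bigr => k kj.
  rewrite lam_colcoef //; last by move=> i iN; rewrite gt_eqF ?W0.
  over.
rewrite -mulr_sumr lam_constE -/c -/l => h.
have -> : c * \sum_(k < N.+1 | (k < j)%N) X k =
   - l * (- (c / l) * \sum_(k < N.+1 | (k < j)%N) X k) by field.
by rewrite -h; field.
Qed.

(* The vectors are g_j = M e_j + t U_j and x_0 - x_star = sum_j c M e_j + t V,
   the values f_j = c M^2 + t df_j and f_star = 0. To first order in t, U makes
   C_{i,j} grow at rate a i j for i < j and keeps |g_j| below M, V makes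
   C_{star,j} grow at rate 1, and |x_0 - x_star| decreases since sum V < 0. *)
Lemma perturbed_gap :
  (forall i j, 0 < a i j) -> 0 < df ord_max ->
  1 + c * M + \sum_(j < N.+1) \sum_(i < N.+1 | (i < j)%N) lambda i j * a i j
    < \sum_n imbalance M D W n * df n ->
  exists2 v, gaps M D W v & M * D / Num.sqrt l < v.
Proof.
move=> a0 dfN hlt.
have l0 : 0 < l by rewrite ltr0n.
have s0 : 0 < Num.sqrt l by rewrite sqrtr_gt0.
have c0 : 0 < c by rewrite divr_gt0 ?mulr_gt0.
have cE : c ^+ 2 * M ^+ 2 * l = D ^+ 2.
  move: s0 (sqr_sqrtr (ltW l0)); rewrite /c -/l.
  by move: (Num.sqrt l) => s s0 <-; field; rewrite !gt_eqF.
have /choice[X hX] (j : 'I_N.+1) : exists X : 'I_N.+1 -> R, forall i : 'I_N.+1,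
    (i < j)%N -> colform (entry W) X i j = a i j - (df i - df j).
  apply: (colform_solve R N.+1 (entry W) j (fun i => a i j - (df i - df j))) =>
    i iN.
  by rewrite gt_eqF // W0.
(* The entries below the diagonal realize the prescribed inner products X j k to first order; the
   diagonal entry -1 makes the squared norm of g_j decrease at rate 2M. *)
pose U (j : 'I_N.+1) : 'rV[R]_N.+1 :=
  \row_k (if (k < j)%N then X j k / M else - (j == k)%:R).
(* Solved from the requirement that C_{star,j} have derivative 1, after eliminating X by
   [perturbation_column]; the term c M compensates the diagonal entry -1 of [U j]. *)
pose V : 'rV[R]_N.+1 := \row_j
  ((1 + df j + l * (\sum_(i < N.+1 | (i < j)%N) lambda i j * (a i j - (df i -
    df j)))
    + c * M) / M).
(* Summation by parts gathers the [df] terms into the imbalance, so the sign of the sum is exactly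
   the assumed strict inequality. *)
have V0 : M * \sum_j V 0 j < 0.
  have -> : M * \sum_j V 0 j = l * (1 + c * M + \sum_(j < N.+1)
       \sum_(i < N.+1 | (i < j)%N) lambda i j * a i j
       - \sum_n imbalance M D W n * df n).
    rewrite imbalance_pairing -/l mulr_sumr.
    transitivity (\sum_(j < N.+1) (1 + c * M + df j
        + l * \sum_(i < N.+1 | (i < j)%N) lambda i j * a i j
        - l * \sum_(i < N.+1 | (i < j)%N) lambda i j * (df i - df j))).
      apply: eq_bigr => j _; rewrite mxE mulrC divfK ?gt_eqF //.
      under eq_bigr do rewrite mulrBr.
      by rewrite sumrB; ring.
    rewrite sumrB !big_split /= -!mulr_sumr !sumr_const !card_ord -(mulr_natl
      M) -/l.
    by field; rewrite gt_eqF.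
  by rewrite pmulr_rlt0 // subr_lt0.
pose g t j := M *: delta_mx 0 j + t *: U j : 'rV[R]_N.+1.
pose p t := const_mx (c * M) + t *: V : 'rV[R]_N.+1.
pose f t j := c * M ^+ 2 + t * df j.
have dot_delta j (v : 'rV[R]_N.+1) : dot (delta_mx 0 j) v = v 0 j.
  rewrite /dot (bigD1 j) //= big1 ?addr0 ?mxE ?eqxx ?mul1r //.
  by move=> k kj; rewrite mxE eqxx (negbTE kj) mul0r.
have dot_const b (v : 'rV[R]_N.+1) : dot (const_mx b) v = b * \sum_k v 0 k.
  by rewrite mulr_sumr; apply: eq_bigr => k _; rewrite mxE.
have ggE t j k : dot (g t j) (g t k) =
    M ^+ 2 *+ (j == k) + t * (M * (U j 0 k + U k 0 j)) + t ^+ 2 * dot (U j) (U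
      k).
  rewrite dotDl !dotDr !dotZl !dotZr (dotC _ _ (U j) (delta_mx _ _)) !dot_delta.
  by rewrite mxE eqxx /= -mulr_natr; ring.
have gpE t j : dot (g t j) (p t) = c * M ^+ 2
    + t * (M * V 0 j + c * M * \sum_k U j 0 k) + t ^+ 2 * dot (U j) V.
  rewrite dotDl !dotDr !dotZl !dotZr (dotC _ _ (U j) (const_mx _)) !dot_delta.
  by rewrite dot_const mxE; ring.
have ppE t : dot (p t) (p t) = D ^+ 2 + t * (2 * c * (M * \sum_k V 0 k))
    + t ^+ 2 * dot V V.
  rewrite dotDl !dotDr !dotZl !dotZr (dotC _ _ V (const_mx _)) !dot_const -cE.
  under eq_bigr do rewrite mxE; rewrite sumr_const card_ord -mulr_natl -/l;
    ring.
have UE (j k : 'I_N.+1) : (k < j)%N -> M * (U j 0 k + U k 0 j) = X j k.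
  move=> kj; rewrite !mxE kj ltnNge (ltnW kj) /= -val_eqE /= ltn_eqF // subr0.
  by rewrite mulrC divfK ?gt_eqF.
have MVE j : M * V 0 j + c * M * \sum_k U j 0 k =
    1 + df j + \sum_(k < N.+1 | (k < j)%N) entry W j k * X j k.
  have -> : \sum_k U j 0 k = (\sum_(k < N.+1 | (k < j)%N) X j k) / M - 1.
    rewrite (bigID (fun k : 'I_N.+1 => (k < j)%N)) /= mulr_suml; congr (_ + _).
      by apply: eq_bigr => k kj; rewrite mxE kj.
    rewrite (bigD1 j) ?ltnn //= mxE ltnn eqxx big1 ?addr0 // => k /andP[/negbTE
      kj jk].
    by rewrite mxE kj eq_sym (negbTE jk) oppr0.
  rewrite mxE mulrC divfK ?gt_eqF //.
  have := perturbation_column _ _ (hX j); set sX := \sum_(k | _) X j k => hc.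
  have -> : c * M * (sX / M - 1) = c * sX - c * M by field; rewrite gt_eqF.
  by rewrite hc; ring.
pose w := entry W.
pose viol t i j := t * (df i - df j)
  + colform w (fun k => dot (g t j) (g t k)) i j.
pose lag t (j : 'I_N.+1) := \sum_(k < N.+1 | (k < j)%N) w j k * dot (g t j) (g
  t k).
have violE t i j : viol t i j = (M ^+ 2 * w i j) *+ (j < i)%N
    + t * (df i - df j + colform w (fun k => M * (U j 0 k + U k 0 j)) i j)
    + t ^+ 2 * colform w (fun k => dot (U j) (U k)) i j.
  rewrite /viol (colform_quadratic _ _ _ _ _ _ _ t _ _ (ggE t j)).
  by rewrite (colform_diag _ _ _ _ (M ^+ 2)) //; ring.
have lagE t j : lag t j = t * (\sum_(k < N.+1 | (k < j)%N) w j k * X j k)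
    + t ^+ 2 * (\sum_(k < N.+1 | (k < j)%N) w j k * dot (U j) (U k)).
  rewrite /lag !mulr_sumr -big_split; apply: eq_bigr => k kj /=.
  by rewrite ggE UE // -val_eqE /= gtn_eqF // mulr0n; ring.
have c2 : 0 < 2 * c by rewrite mulr_gt0.
have cM0 : 0 < c * M ^+ 2 by rewrite mulr_gt0 ?exprn_gt0.
have : \forall t \near 0^'+, [/\ 0 < t, 0 <= D ^+ 2 - dot (p t) (p t),
    (forall j, 0 <= M ^+ 2 - dot (g t j) (g t j)) & [/\ forall j, 0 <= f t j,
    forall j, 0 <= dot (g t j) (p t) - lag t j - f t j &
    forall i j, 0 <= viol t i j]].
  near=> t; split; [| | |split]; near: t.
  - exact: nbhs_right_gt.
  - apply: filterS (quadratic_near_ge0 _ 0 (- (2 * c * (M * \sum_k V 0 k))) (-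
      dot V V) _).
      by move=> t; rewrite ppE; lra.
    by right; split => //; rewrite oppr_gt0 (pmulr_rlt0 _ c2).
  - apply: filter_forall => j.
    apply: filterS (quadratic_near_ge0 _ 0 (2 * M) (- dot (U j) (U j)) _).
      by move=> t; rewrite ggE eqxx mulr1n !mxE ltnn eqxx /= mulr1n; lra.
    by right; split => //; rewrite mulr_gt0.
  - apply: filter_forall => j.
    apply: filterS (quadratic_near_ge0 _ (c * M ^+ 2) (df j) 0 _); last by left.
    by move=> t; rewrite mulr0 addr0.
  - apply: filter_forall => j.
    apply: filterS (quadratic_near_ge0 _ 0 1 (dot (U j) V
      - \sum_(k < N.+1 | (k < j)%N) w j k * dot (U j) (U k)) _); last by right.
    by move=> t; rewrite gpE MVE lagE /f /w; lra.
  - apply: filter_forall => i; apply: filter_forall => j.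
    have [ij|ji|/val_inj ->] := ltngtP i j.
    + apply: filterS (quadratic_near_ge0 _ 0 (a i j)
        (colform w (fun k => dot (U j) (U k)) i j) _); last by right.
      move=> t; rewrite violE ltnNge (ltnW ij) mulr0n.
      rewrite (eq_colform _ _ _ _ _ _ _ (ltnW ij) (UE j)).
      by rewrite hX // [_ + (_ - _)]addrC subrK.
    + apply: filterS (quadratic_near_ge0 _ (M ^+ 2 * w i j) (df i - df j +
        colform w (fun k => M * (U j 0 k + U k 0 j)) i j)
        (colform w (fun k => dot (U j) (U k)) i j) _).
        by move=> t; rewrite violE ji.
      by left; rewrite mulr_gt0 ?exprn_gt0 // W0 // -ltnS.
    + by apply: nearW => t; rewrite /viol /colform !subrr mulr0 addr0.
move=> /filter_ex[t [t0 hp hg [hf hs hc]]].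
exists (f t ord_max - 0).
  apply: (interpolation_gaps _ M D _ _ W (p t) (g t)); try exact: ltW.
  - by rewrite -subr_ge0.
  - by move=> j; rewrite -subr_ge0.
  - exact: hf.
  - by move=> j; rewrite -subr_ge0 dot_iterateB; move: (hs j); rewrite /lag;
      lra.
  - move=> i j; rewrite -subr_ge0 dotBr !dot_iterateB.
    by move: (hc i j); rewrite /viol /colform /f /w; lra.
rewrite subr0 /f; have -> : M * D / Num.sqrt l = c * M ^+ 2.
  by rewrite /c; field; rewrite !gt_eqF.
by rewrite ltrDl mulr_gt0.
Unshelve. all: by end_near. Qed.
End Perturbation.

(** * Balance and nonnegativity of lambda(W) for optimal W *)

Lemma sum_imbalance (R : realType) (M D : R) (N : nat) (W : 'M[R]_N) :
  \sum_n imbalance M D W n = -1.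
Proof.
have := imbalance_pairing R M D N W (fun=> 1).
under eq_bigr do rewrite mulr1; move=> ->.
rewrite sumr_const card_ord mulVf ?pnatr_eq0 // big1 ?sub0r // => j _.
by rewrite big1 // => i _; rewrite subrr mulr0.
Qed.

(** Optimality bounds a linear form in [df] by [K a], while [df] is free except at the last index.
    Hence its other coefficients vanish, and their total -1 fixes the last one. A negative lambda
    would let [K a] fall below -1. *)
Lemma minimax_optimal_lam (R : realType) (M D : R) (N : nat) (W : 'M[R]_N) :
  0 < M -> 0 < D -> minimax_optimal M D W ->
  (forall n, imbalance M D W n = - (n == ord_max)%:R) /\
  (forall i j : 'I_N.+1, (i < j)%N -> 0 <= lam M D W i j).
Proof.
move=> M0 D0 hW; have W0 := minimax_optimal_entry_gt0 _ _ _ _ _ M0 D0 hW.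
pose b := imbalance M D W.
pose K (a : 'I_N.+1 -> 'I_N.+1 -> R) :=
  1 + D / (M * Num.sqrt N.+1%:R) * M
    + \sum_(j < N.+1) \sum_(i < N.+1 | (i < j)%N) lam M D W i j * a i j.
have bK a df : (forall i j, 0 < a i j) -> 0 < df ord_max ->
    \sum_n b n * df n <= K a.
  move=> a0 df0; rewrite leNgt; apply/negP => h.
  have [v gv] := perturbed_gap _ _ _ _ _ a df M0 D0 W0 a0 df0 h.
  by rewrite ltNge (gaps_le_worst_case _ _ _ _ _ _ _ (proj2 hW) gv).
have b0 n : n != ord_max -> b n = 0.
  move=> nN; apply/eqP; apply/negP => /negP bn.
  pose K1 := K (fun _ _ => 1).
  (* With value 1 at the last index, the value at n is tuned so that the linear form equals K1 + 1,
     above the bound K1. *)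
  pose df m := if m == n then (K1 - b ord_max + 1) / b n else (m == ord_max)%:R.
  have := bK (fun _ _ => 1) df (fun _ _ => ltr01).
  rewrite {1}/df eq_sym (negbTE nN) eqxx ltr01 => /(_ isT).
  rewrite (bigD1 n) //= (bigD1 ord_max) 1?eq_sym //= big1 => [|m /andP[mn mN]].
    rewrite /df eqxx [ord_max == n]eq_sym (negbTE nN) eqxx mulrC divfK // -/K1
      mulr1; lra.
  by rewrite /df (negbTE mn) (negbTE mN) mulr0.
have bE n : b n = - (n == ord_max)%:R.
  have [->|/b0 ->] := eqVneq n ord_max; last by rewrite oppr0.
  by have := sum_imbalance R M D N W; rewrite (bigD1 ord_max) //= big1 ?addr0.
split=> // i0 j0 ij0; rewrite leNgt; apply/negP => lneg.
pose K1 := K (fun _ _ => 1).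
(* Scaled so that [K a] is K1 - |K1| - 2, at most -2, whereas the linear form at the indicator of
   the last index is -1. *)
pose s := (`|K1| + 2) / - lam M D W i0 j0.
have s0 : 0 < s by rewrite divr_gt0 ?oppr_gt0 // ltr_wpDl.
pose a (i j : 'I_N.+1) := 1 + s * ((i == i0) && (j == j0))%:R.
have := bK a (fun m => (m == ord_max)%:R).
rewrite eqxx ltr01 (bigD1 ord_max) //= eqxx mulr1 big1 => [|m /negbTE ->];
  last by rewrite mulr0.
have -> : K a = K1 + s * lam M D W i0 j0.
  rewrite /K1 /K -[RHS]addrA; congr (_ + _).
  transitivity (\sum_(j < N.+1) (\sum_(i < N.+1 | (i < j)%N) lam M D W i j * 1
     + \sum_(i < N.+1 | (i < j)%N) s * (lam M D W i j * ((i == i0) && (j ==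
         j0))%:R))).
    apply: eq_bigr => j _; rewrite -big_split; apply: eq_bigr => i _ /=.
    by rewrite /a; ring.
  rewrite big_split /=; congr (_ + _).
  rewrite (bigD1 j0) //= [X in _ + X]big1 ?addr0; last first.
    by move=> j jj; rewrite big1 // => i _; rewrite (negbTE jj) andbF !mulr0.
  rewrite (bigD1 i0) //= big1 ?addr0 ?eqxx ?mulr1 // => i /andP[_ ii].
  by rewrite (negbTE ii) !mulr0.
have -> : s * lam M D W i0 j0 = - (`|K1| + 2) by rewrite /s; field;
  rewrite lt_eqF.
rewrite bE eqxx /= mulr1n addr0 => /(_ _ isT); have := ler_norm K1.
suff ha : forall i j, 0 < a i j by move=> ? /(_ ha); lra.
by move=> i j; rewrite /a ltr_wpDr // mulr_ge0 // ltW.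
Qed.

(** * Dual certificates *)

Lemma sum_delta (R : pzSemiRingType) (I : finType) (F : I -> R) (i : I) :
  \sum_j F j * (j == i)%:R = F i.
Proof.
rewrite (bigD1 i) //= eqxx mulr1 big1 ?addr0 // => j /negbTE ->.
by rewrite mulr0.
Qed.

Section Certificates.
Variables (R : realType) (N : nat) (W : 'M[R]_N).
Implicit Types (F : 'rV[R]_N.+2) (G L Z : 'M[R]_N.+2) (i j k : 'I_N.+1).

Lemma cC_idx_idx F G i j : cC W F G (idx i) (idx j) =
  F 0 (idx i) - F 0 (idx j)
  + colform (entry W) (fun k => G (idx j) (idx k)) i j.
Proof. by rewrite /cC !liftK /colform addrA. Qed.

Lemma cC_star_idx F G j : cC W F G star (idx j) =
  F 0 star - F 0 (idx j) + G star (idx j)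
  - \sum_(k < N.+1 | (k < j)%N) entry W j k * G (idx j) (idx k).
Proof. by rewrite /cC unlift_none liftK. Qed.

Lemma cC_idx_star F G i : cC W F G (idx i) star = F 0 (idx i) - F 0 star.
Proof. by rewrite /cC unlift_none liftK. Qed.

Lemma cC_star_star F G : cC W F G star star = 0.
Proof. by rewrite /cC unlift_none. Qed.

Lemma sum_star_idx (f : 'I_N.+2 -> R) : \sum_a f a = f star + \sum_i f (idx i).
Proof. exact: big_ord_recl. Qed.

(** Collects the coefficient of each entry of F and G under the sparsity that complementary
    slackness provides; it serves both uniqueness and existence. *)
Lemma sum_cC L F G :
  L star star = 0 -> (forall i, L (idx i) star = 0) ->
  (forall i j, (j <= i)%N -> L (idx i) (idx j) = 0) ->
  \sum_a \sum_b L a b * cC W F G a b =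
  F 0 star * (\sum_j L star (idx j))
  + \sum_(n < N.+1) F 0 (idx n) * (\sum_(j < N.+1 | (n < j)%N) L (idx n) (idx j)
      - \sum_(i < N.+1 | (i < n)%N) L (idx i) (idx n) - L star (idx n))
  + \sum_j L star (idx j) * G star (idx j)
  + \sum_(j < N.+1) \sum_(k < N.+1 | (k < j)%N)
      colcoef (entry W) (L star (idx j)) (fun i => L (idx i) (idx j)) j k
      * G (idx j) (idx k).
Proof.
move=> L0 Ls Ll.
rewrite sum_star_idx (sum_star_idx (fun b => L star b * _)) L0 mul0r add0r.
under [X in _ + X = _]eq_bigr => i _ do rewrite sum_star_idx Ls mul0r add0r.
rewrite [X in _ + X = _]exchange_big /=.
have -> : \sum_(n < N.+1) F 0 (idx n) * (\sum_(j < N.+1 | (n < j)%N) L (idx n)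
  (idx j)
      - \sum_(i < N.+1 | (i < n)%N) L (idx i) (idx n) - L star (idx n)) =
    \sum_(j < N.+1) (\sum_(i < N.+1 | (i < j)%N) (F 0 (idx i) * L (idx i) (idx
      j)
      - F 0 (idx j) * L (idx i) (idx j)) - F 0 (idx j) * L star (idx j)).
  under eq_bigr => n _ do rewrite !mulrBr !mulr_sumr.
  rewrite !sumrB (exchange_big_dep predT) //= -sumrB; congr (_ - _).
  by apply: eq_bigr => j _; rewrite sumrB.
rewrite mulr_sumr -!big_split /=; apply: eq_bigr => j _.
rewrite -colform_pairing cC_star_idx.
have -> : \sum_i L (idx i) (idx j) * cC W F G (idx i) (idx j) =
    \sum_(i < N.+1 | (i < j)%N) (F 0 (idx i) * L (idx i) (idx j)
      - F 0 (idx j) * L (idx i) (idx j) + L (idx i) (idx j) *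
      colform (entry W) (fun k => G (idx j) (idx k)) i j).
  rewrite [RHS]big_mkcond; apply: eq_bigr => i _.
  case: ltnP => ij; last by rewrite Ll ?mul0r.
  by rewrite cC_idx_idx; ring.
rewrite big_split sumrB /=; ring.
Qed.

Lemma mxtrace_rank_one_sym Z G (z c : R) :
  G^T = G -> (forall a b, Z a b =
    z * (if a == star then 1 else - c) * (if b == star then 1 else - c)) ->
  \tr (Z *m G) = z * (G star star - 2 * c * \sum_j G star (idx j)
    + c ^+ 2 * (\sum_j G (idx j) (idx j)
       + 2 * \sum_(j < N.+1) \sum_(k < N.+1 | (k < j)%N) G (idx j) (idx k))).
Proof.
move=> GT ZE.
have Gsym a b : G a b = G b a by rewrite -{1}GT mxE.
have upper : \sum_j \sum_k G (idx j) (idx k) = \sum_j G (idx j) (idx j)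
    + 2 * \sum_(j < N.+1) \sum_(k < N.+1 | (k < j)%N) G (idx j) (idx k).
  transitivity (\sum_(j < N.+1) (\sum_(k < N.+1 | (k < j)%N) G (idx j) (idx k)
     + G (idx j) (idx j) + \sum_(k < N.+1 | (j < k)%N) G (idx j) (idx k))).
    apply: eq_bigr => j _;
      rewrite (bigID (fun k : 'I_N.+1 => (k < j)%N)) /= -addrA.
    congr (_ + _); rewrite (bigD1 j) ?ltnn //=; congr (_ + _).
    by apply: eq_bigl => k; rewrite -leqNgt [(j < k)%N]ltn_neqAle eq_sym andbC.
  have lower : \sum_(j < N.+1) \sum_(k < N.+1 | (j < k)%N) G (idx j) (idx k) =
      \sum_(j < N.+1) \sum_(k < N.+1 | (k < j)%N) G (idx j) (idx k).
    rewrite (exchange_big_dep predT) //=.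
    by apply: eq_bigr => j _; apply: eq_bigr => k _; rewrite Gsym.
  by rewrite !big_split /= lower; ring.
rewrite /mxtrace; under eq_bigr do rewrite mxE.
rewrite sum_star_idx sum_star_idx.
under [X in _ + X = _]eq_bigr do rewrite sum_star_idx.
rewrite big_split /=.
under [X in _ + X + _ = _]eq_bigr do rewrite ZE /= (Gsym (idx _)).
under [X in _ + (X + _) = _]eq_bigr do rewrite ZE /= (Gsym star).
under [X in _ + (_ + X) = _]eq_bigr => j _.
  under eq_bigr do rewrite ZE /= Gsym.
  rewrite -mulr_sumr. over.
rewrite ZE /= -!mulr_sumr upper;
  under [X in _ + (_ * X + _) = _]eq_bigr do rewrite Gsym.
ring.
Qed.

(** Free parameters for symmetric matrices: only [X j k] with k <= j is read, and no positivity is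
    imposed, so coefficients can be compared one at a time. *)
Definition gram (x : R) (y : 'I_N.+1 -> R) (X : 'I_N.+1 -> 'I_N.+1 -> R) :
    'M[R]_N.+2 :=
  \matrix_(a, b) match unlift ord0 a, unlift ord0 b with
    | None, None => x
    | None, Some j | Some j, None => y j
    | Some j, Some k => if (k <= j)%N then X j k else X k j
    end.

Lemma tr_gram x y X : (gram x y X)^T = gram x y X.
Proof.
apply/matrixP => a b; rewrite !mxE.
case: unliftP => [j _|_]; case: unliftP => [k _|_] //.
by case: (ltngtP j k) => // /val_inj ->.
Qed.

Lemma gram_star_star x y X : gram x y X star star = x.
Proof. by rewrite mxE unlift_none. Qed.

Lemma gram_star_idx x y X j : gram x y X star (idx j) = y j.
Proof. by rewrite mxE unlift_none liftK. Qed.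

Lemma gram_idx_idx x y X j k : (k <= j)%N ->
  gram x y X (idx j) (idx k) = X j k.
Proof. by move=> kj; rewrite mxE !liftK kj. Qed.

End Certificates.

Arguments gram {R N} x y X.

Lemma psd_kernel (R : realType) (n : nat) (Z : 'M[R]_n) (v : 'cV[R]_n) :
  psd Z -> (v^T *m Z *m v) 0 0 = 0 -> Z *m v = 0.
Proof.
move=> [ZT Z0] v0.
suff h (u : 'cV[R]_n) : (u^T *m Z *m v) 0 0 = 0.
  apply/matrixP => a b; rewrite ord1 [RHS]mxE -(h (delta_mx a 0)).
  by rewrite -mulmxA trmx_delta -rowE [RHS]mxE.
set b := (u^T *m Z *m v) 0 0; pose q := (u^T *m Z *m u) 0 0.
have q0 : 0 <= q by exact: Z0.
have bE : (v^T *m Z *m u) 0 0 = b.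
  rewrite /b -[in RHS](trmxK (u^T *m Z *m v)) [RHS]mxE !trmx_mul trmxK ZT.
  by rewrite mulmxA.
have BE (x y : 'cV[R]_n) (t : R) : ((x - t *: y)^T *m Z *m (x - t *: y)) 0 0 =
    (x^T *m Z *m x) 0 0 - t * (x^T *m Z *m y) 0 0 - t * (y^T *m Z *m x) 0 0
    + t ^+ 2 * (y^T *m Z *m y) 0 0.
  have -> : (x - t *: y)^T = x^T - t *: y^T by apply/matrixP => i j;
    rewrite !mxE.
  rewrite mulmxBl mulmxBr !mulmxBl -!scalemxAr -!scalemxAl.
  have mxB (A B : 'M[R]_1) : (A - B) 0 0 = A 0 0 - B 0 0 by rewrite !mxE.
  have mxZ (A : 'M[R]_1) : (t *: A) 0 0 = t * A 0 0 by rewrite mxE.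
  by rewrite !(mxB, mxZ); ring.
(* Dividing by q + 1 rather than q avoids the case q = 0; this step gives the form the value - (b /
   (q+1))^2 (q+2), which forces b = 0. *)
have := Z0 (v - (b / (q + 1)) *: u); rewrite BE v0 bE -/b -/q.
have q1 : q + 1 != 0 by rewrite gt_eqF // ltr_wpDl.
have -> : 0 - b / (q + 1) * b - b / (q + 1) * b + (b / (q + 1)) ^+ 2 * q =
  - ((b / (q + 1)) ^+ 2 * (q + 2)) by field.
rewrite oppr_ge0 pmulr_lle0 ?ltr_wpDl // => h.
have /eqP : (b / (q + 1)) ^+ 2 = 0 by apply: le_anti; rewrite h sqr_ge0.
by rewrite expf_eq0 /= mulf_eq0 invr_eq0 (negbTE q1) orbF => /eqP.
Qed.

Lemma idx_eq_star (N : nat) (i : 'I_N.+1) : (idx i == star) = false.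
Proof. by rewrite eq_sym; apply/negbTE; exact: neq_lift. Qed.

(** * Uniqueness and existence of the optimal multipliers *)

Section DualOptimality.
Variables (R : realType) (M D : R) (N : nat) (W : 'M[R]_N).
Hypotheses (M0 : 0 < M) (D0 : 0 < D).
Hypothesis W0 : forall n j, (j < n)%N -> (n <= N)%N -> 0 < entry W n j.
Let l : R := N.+1%:R.
Let s : R := Num.sqrt l.
Let c := D / (M * s).

Let l0 : 0 < l. Proof. by rewrite ltr0n. Qed.
Let s0 : 0 < s. Proof. by rewrite sqrtr_gt0. Qed.
Let ssE : s ^+ 2 = l. Proof. exact: sqr_sqrtr (ltW l0). Qed.
Let c0 : 0 < c. Proof. by rewrite divr_gt0 ?mulr_gt0. Qed.

Lemma complementary_slackness (q : multipliers R N) :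
  dual_certificate M D W (M * D / s) q ->
  [/\ forall i, mlambda q (idx i) star = 0,
      forall i j : 'I_N.+1, (j <= i)%N -> mlambda q (idx i) (idx j) = 0 &
      forall a b, mZ q a b = mZ q star star * (if a == star then 1 else - c)
                                * (if b == star then 1 else - c)].
Proof.
(* The identity is tested on the extremal instance, where D, all M_i and the right-hand side vanish;
   what remains is a zero sum of nonnegative terms. *)
move=> [[sig0 lam0 mu0 Zpsd] diag0 /(_ (\row_a (if a == star then 0 else c * M
  ^+ 2))
  (gram (D ^+ 2) (fun _ => c * M ^+ 2) (fun j k => M ^+ 2 *+ (j == k)))
    (tr_gram _ _ _ _ _))].
set F := \row_a _; set G := gram _ _ _.
have Fs : F 0 star = 0 by rewrite mxE eqxx.
have Fi i : F 0 (idx i) = c * M ^+ 2 by rewrite mxE idx_eq_star.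
have Gij i j : G (idx i) (idx j) = M ^+ 2 *+ (i == j).
  by rewrite mxE !liftK; case: ifP => // _; rewrite eq_sym.
(* The rows of P are the vectors x_0 - x_star, g_0, ..., g_N in coordinates. Since G = P P^T, the
   trace splits into quadratic forms at the columns of P, each of which therefore lies in the kernel
   of Z. *)
pose P : 'M[R]_(N.+2, N.+1) :=
  \matrix_(a, k) if unlift ord0 a is Some i then M * (i == k)%:R else c * M.
have Pstar k : P star k = c * M by rewrite mxE unlift_none.
have Pidx i k : P (idx i) k = M * (i == k)%:R by rewrite mxE liftK.
have GE : G = P *m P^T.
  apply/matrixP => a b; rewrite [RHS]mxE; under eq_bigr do rewrite [P^T _ _]mxE.
  have [i ->|->] := unliftP ord0 a; have [j ->|->] := unliftP ord0 b;
    rewrite -/(idx _) -/star.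
  - under eq_bigr do rewrite !Pidx mulrCA mulrA [j == _]eq_sym.
    rewrite sum_delta Gij eq_sym -mulr_natr; ring.
  - under eq_bigr do rewrite Pidx Pstar mulrAC [i == _]eq_sym.
    by rewrite sum_delta mxE unlift_none liftK; ring.
  - under eq_bigr do rewrite Pidx Pstar mulrA [j == _]eq_sym.
    by rewrite sum_delta mxE unlift_none liftK; ring.
  - under eq_bigr do rewrite Pstar.
    rewrite sumr_const card_ord gram_star_star -mulr_natl -/l -ssE /c.
    by field; rewrite !gt_eqF.
have trE : \tr (mZ q *m G) = \sum_k ((col k P)^T *m mZ q *m col k P) 0 0.
  rewrite GE mulmxA mxtrace_mulC mulmxA; apply: eq_bigr => k _.
  by rewrite tr_col -row_mul colE mulmxA -row_mul -colE !mxE.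
have cCii i j : cC W F G (idx i) (idx j) = (M ^+ 2 * entry W i j) *+ (j < i)%N.
  rewrite cC_idx_idx !Fi subrr add0r; exact: colform_diag.
have cC0 a b : 0 <= cC W F G a b.
  have [i ->|->] := unliftP ord0 a; have [j ->|->] := unliftP ord0 b;
    rewrite -/(idx _) -/star.
  - rewrite cCii; case: ltnP => // ji.
    by rewrite mulr_ge0 ?sqr_ge0 // ltW // W0 // -ltnS.
  - by rewrite cC_idx_star Fs Fi subr0 mulr_ge0 ?sqr_ge0 ?(ltW c0).
  - rewrite cC_star_idx Fs Fi gram_star_idx big1 => [|k kj];
      first by rewrite sub0r addNr subr0.
    by rewrite Gij -val_eqE /= gtn_eqF // mulr0.
  - by rewrite cC_star_star.
have -> : cD D G = 0 by rewrite /cD gram_star_star subrr.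
have -> : \sum_i mmu q 0 i * cM M G i = 0.
  by apply: big1 => i _; rewrite /cM Gij eqxx subrr mulr0.
have -> : M * D / s - (F 0 (idx ord_max) - F 0 star) = 0.
  by rewrite Fs Fi /c; field; rewrite !gt_eqF.
rewrite mulr0 add0r addr0 trE => sum0.
have term0 a b : 0 <= mlambda q a b * cC W F G a b by rewrite mulr_ge0.
have quad0 k : 0 <= ((col k P)^T *m mZ q *m col k P) 0 0 by exact: (proj2 Zpsd).
have sum10 : 0 <= \sum_a \sum_b mlambda q a b * cC W F G a b.
  by apply: sumr_ge0 => a _; apply: sumr_ge0.
have sum20 : 0 <= \sum_k ((col k P)^T *m mZ q *m col k P) 0 0 by apply:
  sumr_ge0.
have slack a b : mlambda q a b * cC W F G a b = 0.
  have sum1 : \sum_a \sum_b mlambda q a b * cC W F G a b = 0 by lra.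
  have /(_ a isT) := psumr_eq0P (fun a _ => sumr_ge0 _ (fun b _ => term0 a b))
    sum1.
  by move/(psumr_eq0P (fun b _ => term0 a b)); apply.
have kernel k : mZ q *m col k P = 0.
  apply: psd_kernel => //.
  have sum2 : \sum_k ((col k P)^T *m mZ q *m col k P) 0 0 = 0 by lra.
  exact: (psumr_eq0P (fun k _ => quad0 k) sum2).
have Zidx a k : mZ q a (idx k) = - c * mZ q a star.
  have /matrixP/(_ a 0) := kernel k.
  rewrite !mxE sum_star_idx mxE Pstar; under eq_bigr do rewrite mxE Pidx mulrA.
  rewrite sum_delta => h.
  by apply: (mulIf (lt0r_neq0 M0)); lra.
have Zsym a b : mZ q a b = mZ q b a by rewrite -{1}(proj1 Zpsd) mxE.
split=> [i|i j ji|a b].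
- have /eqP := slack (idx i) star; rewrite cC_idx_star Fs Fi subr0 mulf_eq0.
  by rewrite (gt_eqF (mulr_gt0 c0 (exprn_gt0 2 M0))) orbF => /eqP.
- move: ji; rewrite leq_eqVlt => /orP[/eqP/val_inj ->|ji]; first exact: diag0.
  have /eqP := slack (idx i) (idx j); rewrite cCii ji mulr1n mulf_eq0.
  have iN : (i <= N)%N by rewrite -ltnS.
  by rewrite (gt_eqF (mulr_gt0 (exprn_gt0 2 M0) (W0 _ _ ji iN))) orbF => /eqP.
- have [i ->|->] := unliftP ord0 a; have [j ->|->] := unliftP ord0 b;
    rewrite -/(idx _) -/star ?idx_eq_star ?eqxx.
  + by rewrite Zidx Zsym Zidx; ring.
  + by rewrite Zsym Zidx; ring.
  + by rewrite Zidx; ring.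
  + by rewrite !mulr1.
Qed.


(** Solving for a column X whose [colform] is the indicator of i, and pairing with it, isolates the
    single weight a i. *)
Lemma colcoef_inj (b : R) (a1 a2 : 'I_N.+1 -> R) (j : 'I_N.+1) :
  (forall k : 'I_N.+1, (k < j)%N -> colcoef (entry W) b a1 j k
                                  = colcoef (entry W) b a2 j k) ->
  forall i : 'I_N.+1, (i < j)%N -> a1 i = a2 i.
Proof.
move=> a12 i ij.
have [k kN|X hX] := colform_solve R N.+1 (entry W) j (fun m => (m == i)%:R).
  by rewrite gt_eqF // W0.
have sumE (a : 'I_N.+1 -> R) :
    \sum_(m < N.+1 | (m < j)%N) a m * colform (entry W) X m j = a i.
  under eq_bigr => m mj do rewrite hX //.
  rewrite (bigD1 i) //= eqxx mulr1 big1 ?addr0 // => m /andP[_ /negbTE ->].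
  by rewrite mulr0.
have := colform_pairing R N.+1 (entry W) b a1 X j.
under [RHS]eq_bigr => k kj do rewrite a12 //.
by rewrite -colform_pairing !sumE => /addIr.
Qed.

Lemma dual_multipliers (q : multipliers R N) :
  dual_certificate M D W (M * D / s) q ->
  [/\ msigma q = M / (2 * D * s), forall i, mlambda q star (idx i) = l^-1,
     forall i, mmu q 0 i = D / (2 * M * (l * s)),
     forall a b, mZ q a b = msigma q * (if a == star then 1 else - c)
                                * (if b == star then 1 else - c) &
     [/\ forall i, mlambda q (idx i) star = 0,
      forall i j : 'I_N.+1, (j <= i)%N -> mlambda q (idx i) (idx j) = 0 &
      forall i j : 'I_N.+1, (i < j)%N -> mlambda q (idx i) (idx j) = lam M D W
        i j]].
Proof.
move=> qW; have [lam_star lam_low ZE] := complementary_slackness q qW.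
have {qW} [_ diag0 qE] := qW.
pose z := mZ q star star; pose L := mlambda q.
pose cc (j k : nat) (j' : 'I_N.+1) := colcoef (entry W) (L star (idx j'))
  (fun i => L (idx i) (idx j')) j k.
(* Taking F to be phi at star and 0 elsewhere, the identity becomes a linear form in free parameters
   equal to a constant; indicator data then read off each coefficient. *)
have [K ident] : exists K, forall (phi x : R) y X,
    phi * (\sum_j L star (idx j) - 1) + (z - msigma q) * x
    + \sum_j (L star (idx j) - 2 * c * z) * y j
    + \sum_j (c ^+ 2 * z - mmu q 0 j) * X j j
    + \sum_(j < N.+1) \sum_(k < N.+1 | (k < j)%N)
        (cc j k j + 2 * c ^+ 2 * z) * X j k = K.
  exists (M * D / s - msigma q * D ^+ 2 - \sum_j mmu q 0 j * M ^+ 2) => phi x y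
    X.
  pose F : 'rV[R]_N.+2 := \row_a (if a == star then phi else 0).
  have Fs : F 0 star = phi by rewrite mxE eqxx.
  have Fi i : F 0 (idx i) = 0 by rewrite mxE idx_eq_star.
  have := qE F _ (tr_gram _ _ x y X).
  rewrite sum_cC ?diag0 // (mxtrace_rank_one_sym _ _ _ _ z c (tr_gram _ _ x y
    X) ZE).
  have F0 (f : 'I_N.+1 -> R) : \sum_n F 0 (idx n) * f n = 0.
    by apply: big1 => n _; rewrite Fi mul0r.
  rewrite /cD gram_star_star Fs Fi F0.
  have E1 (f : 'I_N.+1 -> R) : \sum_j f j * gram x y X star (idx j) = \sum_j f
    j * y j.
    by apply: eq_bigr => j _; rewrite gram_star_idx.
  have E2 : \sum_j gram x y X star (idx j) = \sum_j y j.
    by apply: eq_bigr => j _; rewrite gram_star_idx.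
  have E3 : \sum_j gram x y X (idx j) (idx j) = \sum_j X j j.
    by apply: eq_bigr => j _; rewrite gram_idx_idx.
  have E4 : \sum_j mmu q 0 j * cM M (gram x y X) j =
      \sum_j mmu q 0 j * M ^+ 2 - \sum_j mmu q 0 j * X j j.
    by rewrite -sumrB; apply: eq_bigr => j _;
      rewrite /cM gram_idx_idx // mulrBr.
  have E5 (f : 'I_N.+1 -> 'I_N.+1 -> R) : \sum_(j < N.+1) \sum_(k < N.+1 | (k <
    j)%N)
       f j k * gram x y X (idx j) (idx k) =
      \sum_(j < N.+1) \sum_(k < N.+1 | (k < j)%N) f j k * X j k.
    apply: eq_bigr => j _; apply: eq_bigr => k kj.
    by rewrite gram_idx_idx // ltnW.
  have E6 : \sum_(j < N.+1) \sum_(k < N.+1 | (k < j)%N)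
       gram x y X (idx j) (idx k) =
      \sum_(j < N.+1) \sum_(k < N.+1 | (k < j)%N) X j k.
    apply: eq_bigr => j _; apply: eq_bigr => k kj.
    by rewrite gram_idx_idx // ltnW.
  rewrite E1 E2 E3 E4 (E5 (fun j k => cc j k j)) E6 => h.
  under [\sum_j (L star (idx j) - _) * _]eq_bigr do rewrite mulrBl.
  under [\sum_j (_ - mmu q 0 j) * _]eq_bigr do rewrite mulrBl.
  under [\sum_(j < N.+1) \sum_(k < N.+1 | _) (_ + _) * _]eq_bigr => j _.
    under eq_bigr do rewrite mulrDl.
    rewrite big_split /= -mulr_sumr.
    over.
  rewrite !sumrB big_split /= -!mulr_sumr.
  by move: h; rewrite -/L; lra.
have sum0 (f : 'I_N.+1 -> R) : \sum_j f j * 0 = 0.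
  by apply: big1 => j _; rewrite mulr0.
have sum00 (f : 'I_N.+1 -> 'I_N.+1 -> R) :
    \sum_(j < N.+1) \sum_(k < N.+1 | (k < j)%N) f j k * 0 = 0.
  by apply: big1 => j _; apply: big1 => k _; rewrite mulr0.
have K0 : K = 0.
  by rewrite -(ident 0 0 (fun=> 0) (fun _ _ => 0)) !sum0 sum00; ring.
have sigE : msigma q = z.
  by have := ident 0 1 (fun=> 0) (fun _ _ => 0); rewrite !sum0 sum00 K0; lra.
have sumL : \sum_j L star (idx j) = 1.
  by have := ident 1 0 (fun=> 0) (fun _ _ => 0); rewrite !sum0 sum00 K0; lra.
have LE j : L star (idx j) = 2 * c * z.
  have := ident 0 0 (fun i => (i == j)%:R) (fun _ _ => 0).
  by rewrite sum_delta !sum0 sum00 K0; lra.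
have muE j : mmu q 0 j = c ^+ 2 * z.
  have := ident 0 0 (fun=> 0) (fun i k => ((i == j) && (k == j))%:R).
  under [\sum_j (_ - mmu q 0 j) * _]eq_bigr do rewrite andbb.
  rewrite sum_delta sum0 [X in _ + X]big1 ?K0; first by lra.
  move=> i _; apply: big1 => k ki; case: eqP => [<-|] /=; last by rewrite mulr0.
  by rewrite -val_eqE /= ltn_eqF // mulr0.
have ccE (j k : 'I_N.+1) : (k < j)%N -> cc j k j = - (2 * c ^+ 2 * z).
  move=> kj; have := ident 0 0 (fun=> 0) (fun i m => ((i == j) && (m == k))%:R).
  rewrite sum0 [X in _ + X + _]big1; last first.
    move=> i _; case: eqP => [->|] /=; last by rewrite mulr0.
    by rewrite -val_eqE /= gtn_eqF // mulr0.
  rewrite [X in _ + X = _](bigD1 j) //= [X in _ + (X + _)](bigD1 k) //= !eqxx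
    mulr1.
  rewrite [X in _ + (_ + X + _)]big1; last first.
    by move=> m /andP[_ /negbTE ->]; rewrite andbF mulr0.
  rewrite [X in _ + (_ + X) = _]big1 ?K0; first by lra.
  by move=> i /negbTE ij; apply: big1 => m _; rewrite ij mulr0.
(* The weights 2 c z of the star row sum to 1, so 2 l c z = 1 with l = s^2, which fixes z and with
   it every scalar multiplier. *)
have zE : z = M / (2 * D * s).
  have : l * (2 * c * z) = 1.
    rewrite -[RHS]sumL; under eq_bigr do rewrite LE.
    by rewrite sumr_const card_ord -[RHS]mulr_natl.
  have cz : c * (M * s) = D by rewrite /c; field; rewrite !gt_eqF.
  rewrite -ssE => h; apply: (mulIf (x := 2 * D * s)).
    by rewrite !mulf_neq0 ?gt_eqF.
  rewrite divfK ?mulf_neq0 ?gt_eqF // -cz.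
  by rewrite -[RHS]mulr1 -[X in _ = _ * X]h; ring.
have LlE j : L star (idx j) = l^-1.
  by rewrite LE zE -ssE /c; field; rewrite !gt_eqF.
split => //.
- by rewrite sigE.
- by move=> j; rewrite muE zE -ssE /c; field; rewrite !gt_eqF.
- by move=> a b; rewrite ZE sigE.
split=> // i j ij.
apply: (colcoef_inj l^-1 (fun i => L (idx i) (idx j)) (fun i => lam M D W i j)
  j) => // k kj.
rewrite lam_colcoef //; last by move=> m mN; rewrite gt_eqF // W0.
have := ccE j k kj; rewrite /cc LlE => ->.
by rewrite lam_constE -/l -/s -/c zE -ssE /c; field; rewrite !gt_eqF.
Qed.

Definition optimal_multipliers : multipliers R N := Multipliers (M / (2 * D *
  s))
  (\matrix_(a, b) match unlift ord0 a, unlift ord0 b with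
     | Some i, Some j => if (i < j)%N then lam M D W i j else 0
     | None, Some j => l^-1
     | _, None => 0
     end)
  (const_mx (D / (2 * M * (l * s))))
  (\matrix_(a, b) (M / (2 * D * s) * (if a == star then 1 else - c)
                                   * (if b == star then 1 else - c))).

(** The balance of lambda(W) leaves only f_N and f_star, the column equations cancel the
    off-diagonal part of the rank-one Z, and the diagonal, star and constant terms match by the
    choice of scalars. *)
Lemma optimal_multipliers_certificate :
  (forall n, imbalance M D W n = - (n == ord_max)%:R) ->
  (forall i j : 'I_N.+1, (i < j)%N -> 0 <= lam M D W i j) ->
  dual_certificate M D W (M * D / s) optimal_multipliers.
Proof.
move=> flow lam0; pose sig := M / (2 * D * s).
have sig0 : 0 < sig by rewrite divr_gt0 ?mulr_gt0.
pose w : 'cV[R]_N.+2 := \col_a (if a == star then 1 else - c).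
split; first split => /=.
- exact: ltW.
- move=> a b; rewrite mxE; case: unliftP => [i _|_];
    case: unliftP => [j _|_] //.
    by case: ifP => // /lam0.
  by rewrite invr_ge0 ltW.
- by move=> i; rewrite mxE divr_ge0 ?mulr_ge0 // ltW.
- have -> : (\matrix_(a, b) (M / (2 * D * s) * (if a == star then 1 else - c)
        * (if b == star then 1 else - c))) = sig *: (w *m w^T).
    by apply/matrixP => a b; rewrite !mxE big_ord1 !mxE mulrA.
  split; first by rewrite linearZ /= trmx_mul trmxK.
  move=> v; rewrite -scalemxAr -scalemxAl mxE mulr_ge0 ?(ltW sig0) //.
  have -> : v^T *m (w *m w^T) *m v = (w^T *m v)^T *m (w^T *m v).
    by rewrite trmx_mul trmxK !mulmxA.
  by rewrite mxE big_ord1 [X in X * _]mxE -expr2 sqr_ge0.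
- move=> a; rewrite mxE; case: unliftP => [i _|_] //=.
  by rewrite ltnn.
move=> F G GT; pose L := mlambda optimal_multipliers.
have L0 : L star star = 0 by rewrite mxE unlift_none.
have Ls i : L (idx i) star = 0 by rewrite mxE liftK unlift_none.
have Lj j : L star (idx j) = l^-1 by rewrite mxE unlift_none liftK.
have Lij i j : L (idx i) (idx j) = if (i < j)%N then lam M D W i j else 0.
  by rewrite mxE !liftK.
have ZE a b : mZ optimal_multipliers a b = sig * (if a == star then 1 else - c)
   * (if b == star then 1 else - c) by rewrite mxE.
rewrite (mxtrace_rank_one_sym _ _ _ _ sig c GT ZE) sum_cC //; last first.
  by move=> i j ji; rewrite -/L Lij ltnNge ji.
rewrite -/L /cD [msigma _]/= -/sig.
have -> : \sum_j L star (idx j) = 1.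
  under eq_bigr do rewrite Lj.
  by rewrite sumr_const card_ord -[LHS]mulr_natl mulfV ?gt_eqF.
have -> : \sum_j L star (idx j) * G star (idx j) = l^-1 * \sum_j G star (idx j).
  by rewrite mulr_sumr; apply: eq_bigr => j _; rewrite Lj.
have -> : \sum_(n < N.+1) F 0 (idx n) * (\sum_(j < N.+1 | (n < j)%N) L (idx n)
  (idx j)
    - \sum_(i < N.+1 | (i < n)%N) L (idx i) (idx n) - L star (idx n)) = - F 0
        (idx ord_max).
  rewrite -(sum_delta _ _ (fun n => F 0 (idx n))) -sumrN; apply: eq_bigr => n _.
  rewrite -mulrN -flow Lj; congr (_ * (_ - _ - _)); apply: eq_bigr => m mn.
    by rewrite Lij mn.
  by rewrite Lij mn.
have -> : \sum_(j < N.+1) \sum_(k < N.+1 | (k < j)%N)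
      colcoef (entry W) (L star (idx j)) (fun i => L (idx i) (idx j)) j k
      * G (idx j) (idx k)
    = - (c / l) * \sum_(j < N.+1) \sum_(k < N.+1 | (k < j)%N) G (idx j) (idx k).
  rewrite mulr_sumr; apply: eq_bigr => j _; rewrite mulr_sumr;
    apply: eq_bigr => k kj.
  congr (_ * _); rewrite -lam_constE -(lam_colcoef _ _ _ _ W j k) //;
    last first.
    by move=> m mN; rewrite gt_eqF // W0.
  rewrite Lj; congr (_ - (_ + _) * _); apply: eq_bigr => i.
    by case/andP=> _ ij; rewrite Lij ij.
  by move=> ij; rewrite Lij ij.
have -> : \sum_i mmu optimal_multipliers 0 i * cM M G i =
    D / (2 * M * (l * s)) * (l * M ^+ 2 - \sum_j G (idx j) (idx j)).
  have -> : l * M ^+ 2 = \sum_(j < N.+1) M ^+ 2.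
    by rewrite sumr_const card_ord -[RHS]mulr_natl.
  by rewrite -sumrB mulr_sumr; apply: eq_bigr => j _; rewrite mxE.
rewrite -ssE /sig /c; field; rewrite !gt_eqF //.
Qed.
End DualOptimality.

Theorem corollary1p4 (R : realType) (M D : R) (N : nat) (W : 'M[R]_N)
    (hM : 0 < M) (hD : 0 < D) (hN : (1 <= N)%N)
    (hW : @minimax_optimal R M D N W) :
  exists q : multipliers R N,
    unique (dual_optimal M D W) q /\
    [/\ msigma q = M / (2 * D * Num.sqrt N.+1%:R),
        forall i : 'I_N.+1, mlambda q star (idx i) = N.+1%:R^-1,
        forall i : 'I_N.+1, mmu q 0 i = D / (2 * M * N.+1%:R `^ (3 / 2)),
        (let w : 'cV[R]_N.+2 :=
           \col_a (if a == star then 1 else - (D / (M * Num.sqrt N.+1%:R))) in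
         mZ q = msigma q *: (w *m w^T)) &
        [/\ forall i : 'I_N.+1, mlambda q (idx i) star = 0,
            forall i j : 'I_N.+1, (j <= i)%N -> mlambda q (idx i) (idx j) = 0 &
            forall i j : 'I_N.+1, (i < j)%N ->
              mlambda q (idx i) (idx j) = lam M D W i j]].
Proof.
have W0 := minimax_optimal_entry_gt0 _ _ _ _ _ hM hD hW.
have [flow lam0] := minimax_optimal_lam _ _ _ _ _ hM hD hW.
have cert := optimal_multipliers_certificate _ _ _ _ _ hM hD W0 flow lam0.
set q := optimal_multipliers _ _ _ _ _ in cert.
(* The explicit multipliers form a certificate, so their formulas come from the same lemma that
   determines any competitor. *)
have [qs ql qm qZ [qis qlow qlam]] := dual_multipliers _ _ _ _ _ hM hD W0 _
  cert.
exists q; split; last first.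
  split => //.
  - by move=> i; rewrite qm powR_three_halves ?ltr0n.
  - by move=> w; apply/matrixP => a b; rewrite qZ !mxE big_ord1 !mxE mulrA.
split; first by exists (M * D / Num.sqrt N.+1%:R); [exact: (proj2 hW)|].
move=> q' [r]; rewrite (proj2 hW) => -[<-] cert'.
have [qs' ql' qm' qZ' [qis' qlow' qlam']] := dual_multipliers _ _ _ _ _ hM hD
  W0 _ cert'.
have lamE : mlambda q = mlambda q'.
  apply/matrixP => a b.
  have [i ->|->] := unliftP ord0 a; have [j ->|->] := unliftP ord0 b.
  - by case: (ltnP i j) => ij; [rewrite qlam ?qlam'|rewrite qlow ?qlow'].
  - by rewrite qis qis'.
  - by rewrite ql ql'.
  - by case: cert cert' => _ q0 _ [_ q0' _]; rewrite q0 q0'.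
have muE : mmu q = mmu q' by apply/rowP => i; rewrite qm qm'.
have ZE : mZ q = mZ q' by apply/matrixP => a b; rewrite qZ qZ' qs qs'.
have sE : msigma q = msigma q' by rewrite qs qs'.
clearbody q.
by case: q q' lamE muE ZE sE {cert qs ql qm qZ qis qlow qlam cert' qs' ql' qm'
  qZ' qis' qlow' qlam'} => s1 l1 m1 Z1 [s2 l2 m2 Z2] /= -> -> -> ->.
Qed.
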